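(* Let $S$ be a Borel subset of a Polish space. Assume: (i) $K$ is a non-negative linear operator on $\mathcal{B}(S)$ which maps $\mathcal{C}_b(S)$ into itself, and for some integer $k\ge 1$ the operator $K^k:\mathcal{C}_b(S)\to\mathcal{C}_b(S)$ is compact. (ii) $\mu$ is a probability measure on $S$ such that $\mu(U)>0$ for every non-empty (relatively) open set $U\subseteq S$. Then $$\lim_{n\to\infty}\frac1n\log\Big(\int_S (K^n\mathbf{1})(x)\,\mu(dx)\Big)=\log\lambda(K).$$ Further, if $\lambda(K)>0$, then $\lambda(K)$ is the largest eigenvalue of the operator $K$ (acting on $\mathcal{C}_b(S)$), there is a corresponding eigenfunction $\psi\in\mathcal{C}_b(S)$ which is non-negative (and not identically zero), and there exists a non-zero, bounded, non-negative, finitely additive regular measure $m$ on $S$ which is a left eigenvector of $K$ corresponding to the eigenvalue $\lambda(K)$, i.e. $$\int_S (Kf)(x)\,m(dx)=\lambda(K)\int_S f\,dm\qquad\text{for all } f\in\mathcal{C}_b(S).$$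
   Context: $\mathcal{B}(S)$ is the space of bounded measurable real functions on $S$ with the sup norm $\|\cdot\|_\infty$, and $\mathcal{C}_b(S)\subset\mathcal{B}(S)$ is the subspace of bounded continuous functions. $\mathbf 1$ is the constant function $1$. An operator $K$ is non-negative if $g\ge 0$ implies $Kg\ge 0$. For a bounded linear operator $K$ from $\mathcal{B}(S)$ to itself, $\|K\|:=\sup\{\|Kg\|_\infty: g\in\mathcal{B}(S),\|g\|_\infty\le1\}$ and the spectral radius is $\lambda(K):=\lim_{n\to\infty}\|K^n\|^{1/n}$. An operator $T:\mathcal{C}_b(S)\to\mathcal{C}_b(S)$ is compact if for every sequence $(g_n)$ in $\mathcal{C}_b(S)$ with $\|g_n\|_\infty\le 1$ some subsequence of $(Tg_n)$ converges in sup norm. Convention: $\log 0=-\infty$. The dual space of $\mathcal{C}_b(S)$ is the space of bounded, finitely additive, regular (signed) measures on the algebra generated by the closed subsets of $S$; integrals against $m$ are understood in this sense. *)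

(* Defs.v *)
From HB Require Import structures.
From mathcomp Require Import all_boot all_order all_algebra.
From mathcomp Require Import all_classical all_reals all_analysis.

Set Implicit Arguments.
Unset Strict Implicit.
Unset Printing Implicit Defensive.

Import Order.TTheory GRing.Theory Num.Theory.
Import numFieldNormedType.Exports.

Local Open Scope classical_set_scope.
Local Open Scope ring_scope.

(* [completePseudoMetricType] only provides a pseudometric; together with the
   Hausdorff property it is a complete metric. *)
Definition polish (R : realType) (T : completePseudoMetricType R) : Prop :=
  hausdorff_space T /\ exists2 D : set T, countable D & dense D.

(* The subspace [S] with its relative topology.  Measurable types are pointed
   in the library, hence the parameter [s0]; nothing depends on its value. *)
Definition psubspace (T : topologicalType) (S : set T) (s0 : S) : Type :=
  set_type S.

HB.instance Definition _ (T : topologicalType) (S : set T) (s0 : S) :=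
  Topological.copy (psubspace s0) (set_type S).
HB.instance Definition _ (T : topologicalType) (S : set T) (s0 : S) :=
  isPointed.Build (psubspace s0) s0.

Notation borelType X := (g_sigma_algebraType (@open X)).

Section operators.
Context {R : realType} {X : ptopologicalType}.
Implicit Types (f g : X -> R) (K : (X -> R) -> (X -> R)) (r : R).

Definition Bmeas : set (X -> R) :=
  [set f | measurable_fun [set: borelType X] (f : borelType X -> R) /\
           bounded_fun f].

Definition Cb : set (X -> R) := [set f | continuous f /\ bounded_fun f].

Definition supnorm f : R := sup (range (fun x => `|f x|)).

(* Operators on [Bmeas] are represented by maps on all functions; only the
   values on [Bmeas] are constrained or used. *)
Definition linear_on_Bmeas K : Prop :=
  [/\ forall f, Bmeas f -> Bmeas (K f),
      forall f g, Bmeas f -> Bmeas g ->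
        K (fun x => f x + g x) = (fun x => K f x + K g x)
    & forall r f, Bmeas f -> K (fun x => r * f x) = (fun x => r * K f x)].

Definition nonneg_operator K : Prop :=
  forall g, Bmeas g -> (forall x, 0 <= g x) -> forall x, 0 <= K g x.

Definition opnorm K : R :=
  sup [set supnorm (K g) | g in [set g | Bmeas g /\ supnorm g <= 1]].

Definition spectral_radius K : R :=
  limn (fun n : nat => opnorm (iter n K) `^ n%:R^-1).

Definition compact_on_Cb K : Prop :=
  forall g : nat -> X -> R, (forall n, Cb (g n) /\ supnorm (g n) <= 1) ->
  exists (phi : nat -> nat) (h : X -> R),
    [/\ {homo phi : i j / (i < j)%N}, Cb h &
        (fun n => supnorm (fun x => K (g (phi n)) x - h x)) @ \oo --> 0].

Definition eigenfunction_Cb K r f : Prop :=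
  [/\ Cb f, exists x, f x != 0 & K f = (fun x => r * f x)].

Definition eigenvalue_Cb K r : Prop := exists f, eigenfunction_Cb K r f.

End operators.

Definition setalgebra {T : Type} (G : set (set T)) : Prop :=
  [/\ G set0, setU_closed G & setC_closed G].

Notation "'<<a' G '>>'" := (smallest setalgebra G) : classical_set_scope.

Definition closedAlgType (X : Type) : Type := X.

Section closed_algebra.
Variable X : ptopologicalType.

Let clalg : set (set X) := <<a @closed X >>.

Let clalg0 : clalg set0.
Proof. by move=> A [[]]. Qed.

Let clalgU : setU_closed clalg.
Proof.
move=> A B hA hB G GP; have [[_ GU _] _] := GP.
by apply: GU; [exact: hA|exact: hB].
Qed.

Let clalgC : setC_closed clalg.
Proof. by move=> A hA G GP; have [[_ _ GC] _] := GP; apply: GC; exact: hA. Qed.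

Definition closed_alg_display : measure_display := sigma_display clalg.

HB.instance Definition _ := Pointed.copy (closedAlgType X) X.
HB.instance Definition _ := @isAlgebraOfSets.Build closed_alg_display
  (closedAlgType X) clalg clalg0 clalgU clalgC.

End closed_algebra.

Section finitely_additive.
Context {R : realType} {X : ptopologicalType}.
Implicit Types (m : set (closedAlgType X) -> \bar R) (f s : X -> R).

Definition bounded_setfun m : Prop :=
  exists M : R, forall A : set (closedAlgType X), measurable A ->
    (`|m A| <= M%:E)%E.

Definition regular_setfun m : Prop :=
  forall E : set (closedAlgType X), measurable E -> forall e : R, 0 < e ->
  exists F G : set (closedAlgType X),
    [/\ measurable F, measurable G,
        closure (F : set X) `<=` E, E `<=` interior (G : set X)
      & forall C : set (closedAlgType X), measurable C -> C `<=` G `\` F ->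
          (`|m C| < e%:E)%E].

Definition alg_simple s : Prop :=
  finite_set (range s) /\
  forall r : R, measurable (s @^-1` [set r] : set (closedAlgType X)).

(* For bounded [m], the integral of a function that is a uniform limit of
   simple functions over the algebra is the limit of their integrals.
   Every bounded continuous [f] is such a limit, since
   [a <= f < b] is a difference of two closed sets. *)
Definition is_fa_integral m f (I : R) : Prop :=
  exists s : nat -> X -> R,
    [/\ forall n, alg_simple (s n),
        forall e : R, 0 < e ->
          \forall n \near \oo, forall x, `|s n x - f x| < e
      & (fun n => sintegral m (s n)) @ \oo --> I%:E].

Definition fa_integral m f : R := xget 0 [set I | is_fa_integral m f I].

End finitely_additive.

(* Main.v *)
(* A non-negative operator satisfies |K^n| = sup K^n 1.  Put lam = lambda(K) > 0.
   The sums w_N = sum_(n<N) lam^-n K^n 1 are unbounded, for otherwise K would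
   contract them by a factor lam (1 - 1/C) < lam.  Hence for suitable t slightly
   above lam and N large, u = sum_(n<N) t^-n K^n 1 is large at some point x0
   where u is at least half its supremum, while K u - t u stays bounded.
   - The functions u / (2 u(x0)) are approximate eigenfunctions; compactness of
     K^k extracts a limit psi >= 0 with K psi = lam psi.
   - The functionals f |-> (sum_(n<N) t^-n K^n f)(x0) / u(x0) are approximately
     left-invariant; their limit along an ultrafilter is a positive functional
     l on C_b(S) with l(K f) = lam l(f).  As S is normal, Alexandrov's
     representation turns l into a regular content: on closed sets it is
     inf {l f | f >= 1_F}, on the algebra it is the inner approximation by
     closed sets, and uniform approximation by simple functions identifies the
     integral with l.
   - Since K^n 1 >= lam^n psi / |psi| and mu charges open sets, the integral of
     K^n 1 lies between c lam^n and |K^n|, which gives the logarithmic limit. *)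
Require Import Defs.
From HB Require Import structures.
From mathcomp Require Import all_boot all_order all_algebra.
From mathcomp Require Import all_classical all_reals all_analysis.
From mathcomp Require Import measurable_realfun ring lra zify.

Set Implicit Arguments.
Unset Strict Implicit.
Unset Printing Implicit Defensive.

Import Order.TTheory GRing.Theory Num.Theory.
Import numFieldNormedType.Exports.

Local Open Scope classical_set_scope.
Local Open Scope ring_scope.

(** * Bounded continuous functions and Urysohn separation *)

Section bounded_continuous.
Context {R : realType} {X : ptopologicalType}.
Implicit Types (f g : X -> R) (r M : R).

Lemma bounded_funP f : bounded_fun f <-> exists M, forall x, `|f x| <= M.
Proof.
split=> [[M [_ /(_ (M + 1))]]|[M fM]].
  (* The library's bound is valid for every number strictly above [M], hence [M + 1]. *)
  by rewrite ltrDl ltr01 => /(_ isT) fM; exists (M + 1) => x; apply: fM.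
by exists M; split=> [|N MN x _ /=]; rewrite ?num_real// (le_trans (fM x)) ?ltW.
Qed.

Lemma Cb_cst r : Cb (fun _ : X => r).
Proof.
by split; [move=> x; exact: cvg_cst|apply/bounded_funP; exists `|r|].
Qed.

Lemma CbD f g : Cb f -> Cb g -> Cb (fun x => f x + g x).
Proof.
move=> [cf /bounded_funP[M fM]] [cg /bounded_funP[N gN]]; split.
  by move=> x; apply: cvgD; [exact: cf|exact: cg].
apply/bounded_funP; exists (M + N) => x.
by rewrite (le_trans (ler_normD _ _))// lerD.
Qed.

Lemma CbM f g : Cb f -> Cb g -> Cb (fun x => f x * g x).
Proof.
move=> [cf /bounded_funP[M fM]] [cg /bounded_funP[N gN]]; split.
  by move=> x; apply: cvgM; [exact: cf|exact: cg].
apply/bounded_funP; exists (M * N) => x.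
by rewrite normrM ler_pM.
Qed.

Lemma CbZ r f : Cb f -> Cb (fun x => r * f x).
Proof. by move=> cf; apply: CbM => //; exact: Cb_cst. Qed.

Lemma CbN f : Cb f -> Cb (fun x => - f x).
Proof.
by move=> /(CbZ (-1)); congr Cb; apply/funext => x; rewrite mulN1r.
Qed.

Lemma Cb_sum (n : nat) (F : nat -> X -> R) :
  (forall i, Cb (F i)) -> Cb (fun x => \sum_(i < n) F i x).
Proof.
move=> cF; elim: n => [|n IH].
  under eq_fun do rewrite big_ord0; exact: Cb_cst.
under eq_fun do rewrite big_ord_recr/=; exact: CbD.
Qed.

Lemma Cb_urysohn (A B : set X) : normal_space X ->
  closed A -> closed B -> A `&` B = set0 ->
  exists h : X -> R, [/\ Cb h, forall x, 0 <= h x <= 1,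
    forall x, A x -> h x = 0 & forall x, B x -> h x = 1].
Proof.
move=> /(@normal_separatorP R) nX cA cB AB0.
have [h [ch h01 hA hB]] := (uniform_separatorP (R := R) _ _).1 (nX _ _ cA cB AB0).
have {}h01 x : 0 <= h x <= 1 by have := h01 (h x) (imageT _ _); rewrite /= in_itv.
exists h; split => // [|x Ax|x Bx].
- split=> //; apply/bounded_funP; exists 1 => x.
  by have /andP[h0 h1] := h01 x; rewrite ger0_norm.
- by apply: hA; exists x.
- by apply: hB; exists x.
Qed.

Lemma open_gt_preimage f r : continuous f -> open [set x | r < f x].
Proof.
by move=> cf; apply: (@open_comp _ _ f [set y | r < y]) => [x _|]; [exact: cf|exact: open_gt].
Qed.

Lemma closed_le_preimage f r : continuous f -> closed [set x | f x <= r].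
Proof.
by move=> cf; apply: (@closed_comp _ _ f [set y | y <= r]) => [x _|]; [exact: cf|exact: closed_le].
Qed.

Lemma closed_ge_preimage f r : continuous f -> closed [set x | r <= f x].
Proof.
by move=> cf; apply: (@closed_comp _ _ f [set y | r <= y]) => [x _|]; [exact: cf|exact: closed_ge].
Qed.

End bounded_continuous.

(** * Alexandrov's representation of positive functionals by regular contents *)

Section alexandrov.
Context {R : realType} {X : ptopologicalType} (normalX : normal_space X).
Context (l : (X -> R) -> R).
Context (lD : forall f g, Cb f -> Cb g ->
  l (fun x => f x + g x) = l f + l g).
Context (lZ : forall r f, Cb f -> l (fun x => r * f x) = r * l f).
Context (l_ge0 : forall f, Cb f -> (forall x, 0 <= f x) -> 0 <= l f).
Implicit Types (f g : X -> R) (r M e : R) (A B D E F G : set X).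

Let one : X -> R := fun=> 1.

Lemma functionalN f : Cb f -> l (fun x => - f x) = - l f.
Proof.
by move=> cf; rewrite -mulN1r -lZ//; congr l; apply/funext => x; rewrite mulN1r.
Qed.

Lemma functional_le f g : Cb f -> Cb g -> (forall x, f x <= g x) -> l f <= l g.
Proof.
move=> cf cg fg; rewrite -subr_ge0 -functionalN// -lD//; last exact: CbN.
by apply: l_ge0 => [|x]; [apply: CbD => //; exact: CbN|rewrite subr_ge0].
Qed.

Definition dominates f F :=
  [/\ Cb f, forall x, 0 <= f x & forall x, F x -> 1 <= f x].

(* The value on closed sets of the measure representing [l]. *)
Definition cap F : R := inf [set l f | f in [set f | dominates f F]].

Lemma dominates_one F : dominates one F.
Proof. by split; [exact: Cb_cst|move=> x; exact: ler01|]. Qed.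

Lemma functional_one_ge0 : 0 <= l one.
Proof. by have [c1 p1 _] := dominates_one set0; exact: l_ge0. Qed.

Lemma cap_has_inf F : has_inf [set l f | f in [set f | dominates f F]].
Proof.
split; first by exists (l one); exists one => //; exact: dominates_one.
by exists 0 => _ [f [cf f0 _] <-]; exact: l_ge0.
Qed.

Lemma cap_le F f : dominates f F -> cap F <= l f.
Proof. by move=> Ff; apply: ge_inf; [exact: (cap_has_inf F).2|exists f]. Qed.

Lemma cap_ge F r : (forall f, dominates f F -> r <= l f) -> r <= cap F.
Proof.
move=> rF; apply: lb_le_inf; first exact: (cap_has_inf F).1.
by move=> _ [f Ff <-]; exact: rF.
Qed.

Lemma cap_adherent F e : 0 < e -> exists2 f, dominates f F & l f < cap F + e.
Proof. by move=> e0; have [_ [f Ff <-]] := inf_adherent e0 (cap_has_inf F); exists f. Qed.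

Lemma cap_ge0 F : 0 <= cap F.
Proof. by apply: cap_ge => f [cf f0 _]; exact: l_ge0. Qed.

Lemma cap_le1 F : cap F <= l one.
Proof. exact/cap_le/dominates_one. Qed.

Lemma capT : cap setT = l one.
Proof.
apply/eqP; rewrite eq_le cap_le1/=; apply: cap_ge => f [cf f0 f1].
by apply: functional_le => // [|x]; [exact: Cb_cst|exact: f1].
Qed.

Lemma cap_mono A B : A `<=` B -> cap A <= cap B.
Proof.
move=> AB; apply: cap_ge => f [cf f0 f1]; apply: cap_le; split=> // x /AB.
exact: f1.
Qed.

(** A Urysohn function [h] splits every majorant [f] of the union into [f * (1 - h)] and [f * h],
    which dominate [A] and [B] respectively. *)
Lemma cap_disjoint A B : closed A -> closed B -> A `&` B = set0 ->
  cap A + cap B <= cap (A `|` B).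
Proof.
move=> cA cB AB0; have [h [ch h01 hA hB]] := Cb_urysohn (R := R) normalX cA cB AB0.
apply: cap_ge => f [cf f0 f1].
have cfh := CbM cf ch; have cfh' := CbD cf (CbN cfh).
have -> : l f = l (fun x => f x - f x * h x) + l (fun x => f x * h x).
  by rewrite -lD//; congr l; apply/funext => x; rewrite subrK.
apply: lerD; apply: cap_le; split=> // x.
- by rewrite subr_ge0 ler_piMr//; have /andP[] := h01 x.
- by move=> Ax; rewrite hA// mulr0 subr0; apply: f1; left.
- by rewrite mulr_ge0//; have /andP[] := h01 x.
- by move=> Bx; rewrite hB// mulr1; apply: f1; right.
Qed.

(** Extends [cap] from closed sets to all sets. On disjoint sets it is in general only
    superadditive; additivity will come from Caratheodory's condition. *)
Definition inner E : R := sup [set cap F | F in [set F | closed F /\ F `<=` E]].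

Lemma inner_has_sup E :
  has_sup [set cap F | F in [set F | closed F /\ F `<=` E]].
Proof.
split; first by exists (cap set0); exists set0 => //; split=> //; exact: closed0.
by exists (l one) => _ [F _ <-]; exact: cap_le1.
Qed.

Lemma inner_ge E F : closed F -> F `<=` E -> cap F <= inner E.
Proof.
by move=> cF FE; apply: sup_upper_bound; [exact: inner_has_sup|exists F].
Qed.

Lemma inner_le E r :
  (forall F, closed F -> F `<=` E -> cap F <= r) -> inner E <= r.
Proof.
move=> Er; apply: ge_sup; first exact: (inner_has_sup E).1.
by move=> _ [F [cF FE] <-]; exact: Er.
Qed.

Lemma inner_adherent E e : 0 < e ->
  exists F, [/\ closed F, F `<=` E & inner E - e < cap F].
Proof.
by move=> e0; have [_ [F [cF FE] <-]] := sup_adherent e0 (inner_has_sup E); exists F.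
Qed.

Lemma inner_closed F : closed F -> inner F = cap F.
Proof.
move=> cF; apply/eqP; rewrite eq_le inner_ge// andbT.
by apply: inner_le => G _; exact: cap_mono.
Qed.

Lemma inner_mono A B : A `<=` B -> inner A <= inner B.
Proof.
by move=> AB; apply: inner_le => F cF FA; apply: inner_ge => //; exact: subset_trans AB.
Qed.

Lemma inner_ge0 E : 0 <= inner E.
Proof. by apply: le_trans (cap_ge0 set0) (inner_ge closed0 _). Qed.

Lemma innerT : inner setT = l one.
Proof. by rewrite inner_closed ?capT//; exact: closedT. Qed.

Lemma inner_le1 E : inner E <= l one.
Proof. by rewrite -innerT; exact: inner_mono. Qed.

Lemma inner_disjoint A B : A `&` B = set0 ->
  inner A + inner B <= inner (A `|` B).
Proof.
move=> AB0; apply/ler_addgt0Pr => e e0.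
have [F [cF FA hF]] := inner_adherent A (divr_gt0 e0 (ltr0n R 2)).
have [G [cG GB hG]] := inner_adherent B (divr_gt0 e0 (ltr0n R 2)).
have FG0 : F `&` G = set0 by apply: subsetI_eq0 AB0.
have := cap_disjoint cF cG FG0.
have := inner_ge (closedU cF cG) (setUSS FA GB).
lra.
Qed.

(* Caratheodory's condition, for an inner instead of an outer set function;
   it makes [inner] additive without any separate regularity argument. *)
Definition caratheodory_splits E :=
  forall D, inner D = inner (D `&` E) + inner (D `&` ~` E).

Lemma inner_split_ge E D : inner (D `&` E) + inner (D `&` ~` E) <= inner D.
Proof.
apply: le_trans (inner_disjoint _) _; first by rewrite setIACA setICr setI0.
by rewrite -setIUr setUv setIT.
Qed.

(** Superadditivity gives one inequality. For the other, a majorant of the part of [H] in [F],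
    scaled up slightly, still dominates [H] off a closed subset of [H] that avoids [F]; a second
    majorant takes care of that subset. *)
Lemma splits_closed F : closed F -> caratheodory_splits F.
Proof.
move=> cF D; apply/eqP; rewrite eq_le inner_split_ge andbT.
apply: inner_le => H cH HD.
suff HF : cap H <= cap (H `&` F) + inner (H `&` ~` F).
  apply: le_trans HF _; apply: lerD; first by apply: inner_ge; [exact: closedI|exact: setSI].
  by apply: inner_mono; apply: setSI.
apply/ler_addgt0Pr => e e0; have l0 := functional_one_ge0.
(* This choice ensures [d <= 1] and [d * (l one + 3) <= e], enough to absorb every error term of the
   final estimate. *)
pose d := e / (e + l one + 3).
have d0 : 0 < d by rewrite divr_gt0//; lra.
have dE : d * (e + l one + 3) = e by rewrite /d divfK// gt_eqF//; lra.
have d1 : d <= 1 by rewrite ler_pdivrMr; lra.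
have [f [cf f0 f1] lf] := cap_adherent (H `&` F) d0.
(* The threshold lies below 1 so that this closed set misses the part of [H] in [F], where [f >= 1];
   outside [G], [(1 + d) * f] exceeds 1. *)
pose G := [set x | f x <= (1 + d)^-1].
have cHG : closed (H `&` G).
  by apply: closedI => //; apply: closed_le_preimage; case: cf.
have [g [cg g0 g1] lg] := cap_adherent (H `&` G) d0.
have HGF : cap (H `&` G) <= inner (H `&` ~` F).
  apply: inner_ge => // x [Hx Gx]; split => // Fx.
  have := le_trans (f1 x (conj Hx Fx)) Gx.
  by rewrite invr_ge1 ?unitfE ?gt_eqF//; lra.
have : cap H <= l (fun x => (1 + d) * f x + g x).
  apply: cap_le; split=> [|x|x Hx].
  - by apply: CbD => //; exact: CbZ.
  - by rewrite addr_ge0// mulr_ge0//; lra.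
  - have [fx|fx] := leP (f x) (1 + d)^-1.
      rewrite (le_trans (g1 x (conj Hx fx)))// lerDr mulr_ge0//; lra.
    have : 1 <= (1 + d) * f x.
      by rewrite -ler_pdivrMl ?mulr1 ?ltW//; lra.
    have := g0 x; lra.
rewrite lD ?lZ//; last exact: CbZ.
have := cap_le1 (H `&` F).
nra.
Qed.

Lemma splitsC E : caratheodory_splits E -> caratheodory_splits (~` E).
Proof. by move=> sE D; rewrite setCK addrC. Qed.

(** [D] is cut by [A] first, then its part outside [A] is cut by [B]. *)
Lemma splitsU A B : caratheodory_splits A -> caratheodory_splits B ->
  caratheodory_splits (A `|` B).
Proof.
move=> sA sB D; rewrite (sA (D `&` (A `|` B))) (sA D) (sB (D `&` ~` A)).
have -> : D `&` (A `|` B) `&` A = D `&` A.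
  by rewrite -setIA setUK.
have -> : D `&` (A `|` B) `&` ~` A = D `&` ~` A `&` B.
  by rewrite -!setIA; congr (_ `&` _); rewrite setIUl setICr set0U setIC.
by rewrite -(setIA D (~` A) (~` B)) -setCU addrA.
Qed.

(** The sets that split every [D] form an algebra containing the closed sets, and measurability here
    means membership in every such algebra. *)
Lemma measurable_splits (E : set (closedAlgType X)) :
  measurable E -> caratheodory_splits E.
Proof.
move=> mE; apply: (mE caratheodory_splits); split; last exact: splits_closed.
split; [exact/splits_closed/closed0|exact: splitsU|exact: splitsC].
Qed.

Lemma measurable_closed F : closed F -> measurable (F : set (closedAlgType X)).
Proof. by move=> cF; change ((<<a @closed X >>) F); move=> B [_]; apply. Qed.

Lemma splits_additive A B : caratheodory_splits A -> A `&` B = set0 ->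
  inner (A `|` B) = inner A + inner B.
Proof.
move=> sA AB0; rewrite (sA (A `|` B)) setUK setIUl setICr set0U.
by congr (_ + inner _); apply/setIidPl/disjoints_subset; rewrite setIC.
Qed.

(** * The inner set function as a bounded regular content *)

Let m (E : set (closedAlgType X)) : \bar R := (inner E)%:E.

Let m_ge0 E : (0 <= m E)%E.
Proof. by rewrite lee_fin; exact: inner_ge0. Qed.

Let m_semi_additive : measure_function.semi_additive m.
Proof.
apply/additive2P => [|A B mA mB AB0]; last first.
  by rewrite /m splits_additive//; exact: measurable_splits.
congr EFin; have := @splits_additive set0 set0 (splits_closed closed0) (setI0 _).
rewrite setU0; lra.
Qed.

HB.instance Definition _ :=
  isContent.Build _ (closedAlgType X) R m m_ge0 m_semi_additive.

(** Closed sets [F] in [E] and [G] in its complement nearly exhaust the total mass, as [E] splits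
    the whole space; whatever is disjoint from both has mass below [e]. The outer set is the
    complement of [G]. *)
Let m_regular : regular_setfun m.
Proof.
move=> E mE e e0; have e2 : 0 < e / 2 by rewrite divr_gt0.
have [F [cF FE hF]] := inner_adherent E e2.
have [G [cG GE hG]] := inner_adherent (~` E) e2.
exists F, (~` G); split.
- exact: measurable_closed.
- by apply: measurableC; exact: measurable_closed.
- by rewrite -(closure_id _).1.
- rewrite (interior_id _).1 ?openC//; exact: subsetCr.
move=> C mC CGF; rewrite gee0_abs ?m_ge0// lte_fin.
have CF0 : C `&` F = set0.
  by apply/disjoints_subset => x /CGF[].
have CFG0 : (C `|` F) `&` G = set0.
  apply/disjoints_subset => x [/CGF[]//|/FE Ex Gx].
  by have := GE x Gx.
have := inner_disjoint CF0; have := inner_disjoint CFG0.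
have := inner_le1 (C `|` F `|` G).
have := measurable_splits mE setT; rewrite !setTI innerT.
rewrite (inner_closed cF) (inner_closed cG).
lra.
Qed.

Let m_bounded : bounded_setfun m.
Proof.
exists (l one) => A mA; rewrite gee0_abs ?m_ge0// lee_fin; exact: inner_le1.
Qed.

(** * Integration of continuous functions against the content *)

Lemma inner0 : inner set0 = 0.
Proof.
have := splits_additive (splits_closed closed0) (setI0 (set0 : set X)).
rewrite setU0; lra.
Qed.

(** Induction over the values: each one splits off its level set, and the rest of [D] takes only the
    remaining values. *)
Lemma inner_partition (s : X -> R) (rs : seq R) D : uniq rs ->
  (forall r, caratheodory_splits (s @^-1` [set r])) -> (forall x, D x -> s x \in rs) ->
  inner D = \sum_(r <- rs) inner (D `&` s @^-1` [set r]).
Proof.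
elim: rs D => [|r rs IH] D /=.
  move=> _ _ D0; rewrite big_nil (_ : D = set0) ?inner0//.
  by rewrite -subset0 => x /D0.
move=> /andP[rrs urs] hs hD; rewrite big_cons (hs r D); congr (_ + _).
rewrite IH//; last first.
  by move=> x [/hD]; rewrite inE => /orP[/eqP sx /(_ sx)|].
apply: eq_big_seq => q qrs; congr inner; apply/seteqP; split=> x /=.
  by move=> [[Dx _] sx].
move=> [Dx sx]; split=> //; split=> //; rewrite sx => qr.
by move: rrs; rewrite -qr qrs.
Qed.

(** A Urysohn function separating [F r] from the other closed sets divides [f] into one piece that
    bounds the first summand and one to which induction applies. *)
Lemma cap_sum_le (s : X -> R) (rs : seq R) (F : R -> set X) (c : R -> R) f :
  uniq rs -> (forall r, closed (F r)) -> (forall r, F r `<=` s @^-1` [set r]) ->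
  {in rs, forall r, 0 <= c r} -> Cb f -> (forall x, 0 <= f x) ->
  {in rs, forall r x, F r x -> c r <= f x} ->
  \sum_(r <- rs) c r * cap (F r) <= l f.
Proof.
move=> + cF Fs; elim: rs f => [|r rs IH] f /=.
  by move=> _ _ cf f0 _; rewrite big_nil l_ge0.
move=> /andP[rrs urs] c0 cf f0 fc.
have cB : closed (\big[setU/set0]_(q <- rs) F q) by exact: closed_bigsetU.
have FB0 : F r `&` \big[setU/set0]_(q <- rs) F q = set0.
  rewrite -bigcup_seq; apply/disjoints_subset => x /Fs /= sx [q /= qrs /Fs /= sq].
  by move: rrs; rewrite -sx sq qrs.
have [h [ch h01 hA hB]] := Cb_urysohn (R := R) normalX (cF r) cB FB0.
have cfh := CbM cf ch; have cfh' := CbD cf (CbN cfh).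
have fh0 x : 0 <= f x - f x * h x.
  by rewrite subr_ge0 ler_piMr//; have /andP[] := h01 x.
have -> : l f = l (fun x => f x - f x * h x) + l (fun x => f x * h x).
  by rewrite -lD//; congr l; apply/funext => x; rewrite subrK.
rewrite big_cons; apply: lerD.
  (* Dividing by [c r] requires it to be positive; a zero coefficient contributes nothing. *)
  have := c0 _ (mem_head _ _); rewrite le_eqVlt => /predU1P[<-|cr0].
    by rewrite mul0r l_ge0.
  rewrite -ler_pdivlMl// -lZ//; apply: cap_le; split=> [|x|x Fx].
  - exact: CbZ.
  - by rewrite mulr_ge0// invr_ge0 ltW.
  - rewrite hA// mulr0 subr0 ler_pdivlMl// mulr1.
    exact: fc (mem_head _ _) _ Fx.
apply: IH => // [q qrs|x|q qrs x Fx].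
- by apply: c0; rewrite inE qrs orbT.
- by rewrite mulr_ge0//; have /andP[] := h01 x.
- rewrite hB ?mulr1; first by apply: fc Fx; rewrite inE qrs orbT.
  by rewrite -bigcup_seq; exists q.
Qed.

(** The level sets are approximated from inside by closed sets, to which [cap_sum_le] applies once
    [c] and [f] are shifted by a constant to become non-negative; the shift cancels because the
    level sets carry total mass [l one]. *)
Lemma level_sum_le (s : X -> R) (c : R -> R) f : alg_simple s -> Cb f ->
  (forall x, c (s x) <= f x) ->
  \sum_(r <- finmap.enum_fset (fset_set (range s))) c r * inner (s @^-1` [set r]) <= l f.
Proof.
move=> [fs ms] cf cs; set rs := finmap.enum_fset _.
have urs : uniq rs by exact: finmap.fset_uniq.
have srs x : s x \in rs by rewrite in_fset_set// inE; exists x.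
have ss r : caratheodory_splits (s @^-1` [set r]) by apply: measurable_splits; exact: ms.
have [_ /bounded_funP[M0 fM0]] := cf.
(* Large enough to make both [c r + M] and [f + M] non-negative. *)
pose M := M0 + \sum_(r <- rs) `|c r|.
have M0_ge0 : 0 <= M0 by rewrite (le_trans _ (fM0 point)).
have cM : {in rs, forall r, 0 <= c r + M}.
  move=> r rrs; rewrite /M (perm_big _ (perm_to_rem rrs))/= big_cons.
  have := ler_norm (- c r); rewrite normrN.
  have : 0 <= \sum_(j <- rem r rs) `|c j| by exact: sumr_ge0.
  lra.
pose S := \sum_(r <- rs) (c r + M).
have S0 : 0 <= S by rewrite /S big_seq; exact: sumr_ge0.
apply/ler_addgt0Pr => e e0.
(* Each closed set loses at most [d], which makes a weighted loss of at most [d * S <= e]; the 1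
   avoids division by zero. *)
pose d := e / (1 + S).
have d0 : 0 < d by rewrite divr_gt0//; lra.
have dS : d * (1 + S) = e by rewrite /d divfK// gt_eqF//; lra.
have [F hF] := choice (fun r => inner_adherent (s @^-1` [set r]) d0).
have : \sum_(r <- rs) (c r + M) * cap (F r) <= l (fun x => f x + M * one x).
  apply: (@cap_sum_le s) => // [r|r||x|r rrs x Fx].
  - by have [] := hF r.
  - by have [] := hF r.
  - by apply: CbD => //; apply: CbZ; exact: Cb_cst.
  - rewrite /one mulr1 /M; have := fM0 x; rewrite ler_norml => /andP[+ _].
    have : 0 <= \sum_(j <- rs) `|c j| by exact: sumr_ge0.
    lra.
  - have [_ /(_ x Fx)/= sx _] := hF r.
    by rewrite /one mulr1 lerD2r -sx.
rewrite lD ?lZ//; [|exact: Cb_cst|by apply: CbZ; exact: Cb_cst].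
have -> : l one = \sum_(r <- rs) inner (s @^-1` [set r]).
  rewrite -innerT (inner_partition urs ss)//.
  by apply: eq_bigr => r _; rewrite setTI.
have : \sum_(r <- rs) (c r + M) * (inner (s @^-1` [set r]) - d) <=
    \sum_(r <- rs) (c r + M) * cap (F r).
  rewrite !big_seq; apply: ler_sum => r rrs; rewrite ler_wpM2l ?cM//.
  by have [_ _ /ltW] := hF r.
have -> : \sum_(r <- rs) (c r + M) * (inner (s @^-1` [set r]) - d) =
    \sum_(r <- rs) c r * inner (s @^-1` [set r]) +
    M * (\sum_(r <- rs) inner (s @^-1` [set r])) - d * S.
  rewrite /S !mulr_sumr -big_split/= -sumrB; apply: eq_bigr => r _; ring.
nra.
Qed.

Lemma level_sum1 (s : X -> R) : alg_simple s ->
  \sum_(r <- finmap.enum_fset (fset_set (range s))) inner (s @^-1` [set r]) = l one.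
Proof.
move=> [fs ms]; rewrite -innerT.
rewrite (inner_partition (s := s) (D := setT) (finmap.fset_uniq (fset_set (range s)))).
- by apply: eq_bigr => r _; rewrite setTI.
- by move=> r; apply: measurable_splits; exact: ms.
- by move=> x _; rewrite in_fset_set// inE; exists x.
Qed.

(** The lower bound [level_sum_le] is used twice, for [s - e <= f] and for [- s - e <= - f], which
    yields both sides of the estimate. *)
Let sintegral_dist (s : X -> R) f e : alg_simple s -> Cb f ->
  (forall x, `|s x - f x| <= e) ->
  exists2 I, sintegral m s = I%:E & `|I - l f| <= e * l one.
Proof.
move=> as_ cf sf; have [fs ms] := as_.
exists (\sum_(r <- finmap.enum_fset (fset_set (range s))) r * inner (s @^-1` [set r])).
  (* [sintegral] sums over all reals; values outside the range have empty level sets, of content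
     0. *)
  rewrite /sintegral -(fsbig_widen (range s))//=; last first.
    by move=> r [_ nr] /=; rewrite preimage10// /m inner0 mule0.
  by rewrite fsbig_finite// -sumEFin; apply: eq_bigr => r _; rewrite EFinM.
rewrite ler_norml; apply/andP; split.
  have /(@level_sum_le s (fun r => - r - e) _ as_ (CbN cf)) : forall x, - s x - e <= - f x.
    by move=> x; have := sf x; rewrite ler_norml => /andP[]; lra.
  under eq_bigr do rewrite mulrBl mulNr.
  rewrite sumrB sumrN -mulr_sumr level_sum1// functionalN//; lra.
have /(@level_sum_le s (fun r => r - e) _ as_ cf) : forall x, s x - e <= f x.
  by move=> x; have := sf x; rewrite ler_norml => /andP[]; lra.
under eq_bigr do rewrite mulrBl.
rewrite sumrB -mulr_sumr level_sum1//; lra.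
Qed.

(** [f] is rounded down to the grid of mesh [1 / (n + 1)]; non-empty level sets are differences of
    two closed sets, and boundedness leaves finitely many values. *)
Lemma alg_simple_approx f (n : nat) : Cb f ->
  exists2 s : X -> R, alg_simple s & forall x, `|s x - f x| <= n.+1%:R^-1.
Proof.
move=> [cf /bounded_funP[M fM]].
have n0 : 0 < n.+1%:R :> R by rewrite ltr0n.
pose s x : R := (Num.floor (n.+1%:R * f x))%:~R / n.+1%:R.
exists s; last first.
  move=> x; rewrite /s [X in _ - X](_ : f x = n.+1%:R * f x / n.+1%:R); last first.
    by rewrite mulrAC divff ?gt_eqF// mul1r.
  rewrite -mulrBl normrM [X in _ * X]gtr0_norm ?invr_gt0// ler_piMl ?invr_ge0//.
  have := floor_itv (n.+1%:R * f x); rewrite intrD ler_norml => /andP[? ?].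
  by apply/andP; split; lra.
split.
  have [N MN] : exists N : nat, n.+1%:R * M <= N%:R.
    exists (Num.bound `|n.+1%:R * M|).
    by apply: le_trans (ler_norm _) (ltW (archi_boundP _)).
  (* The floors lie between [- (N + 1)] and [N]; adding [N + 1] makes them natural numbers. *)
  apply: (@sub_finite_set _ _ [set (k%:R - N.+1%:R) / n.+1%:R | k in `I_(N.+1 + N.+2)]).
    move=> _ [x _ <-].
    have := fM x; rewrite ler_norml => /andP[f1 f2].
    have F1 : - (N.+1%:Z) <= Num.floor (n.+1%:R * f x).
      rewrite floor_ge_int mulrNz -pmulrn -addn1 natrD.
      have := ler_wpM2l (ltW n0) f1; lra.
    have F2 : Num.floor (n.+1%:R * f x) <= N%:Z.
      rewrite -(ler_int R) (le_trans (floor_le _))// -pmulrn.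
      have := ler_wpM2l (ltW n0) f2; lra.
    rewrite /s; set z := Num.floor _ in F1 F2 *.
    exists `|(z + N.+1%:Z)%R|%N; first by rewrite /=; lia.
    by rewrite pmulrn gez0_abs ?intrD -?pmulrn ?addrK//; lia.
  exact/finite_image/finite_II.
move=> r; have [[x sx]|nr] := pselect (exists x, s x = r); last first.
  rewrite (_ : s @^-1` [set r] = set0); first exact: measurable0.
  by rewrite -subset0 => x /= sx; apply: nr; exists x.
set j := Num.floor (n.+1%:R * f x).
have -> : s @^-1` [set r] = [set y | j%:~R / n.+1%:R <= f y] `&`
    ~` [set y | (j + 1)%:~R / n.+1%:R <= f y].
  apply/seteqP; split=> y /=.
    rewrite -sx /s => /(mulIf (invr_neq0 (lt0r_neq0 n0))) /intr_inj yx.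
    have := floor_itv (n.+1%:R * f y); rewrite yx -/j !ler_pdivrMr// mulrC.
    by move=> /andP[? ?]; split=> //; apply/negP; rewrite -ltNge.
  rewrite !ler_pdivrMr// => -[jy /negP]; rewrite -ltNge => yj.
  by rewrite -sx /s -/j; congr (_%:~R / _); apply: floor_def; rewrite mulrC jy.
apply: measurableI; first by apply: measurable_closed; exact: closed_ge_preimage.
by apply: measurableC; apply: measurable_closed; exact: closed_ge_preimage.
Qed.

(** [xget] would fall back to 0 if no value existed, so existence is shown first, by grid
    approximations; uniqueness holds since [sintegral_dist] forces the integrals of every
    approximating sequence to tend to [l f]. *)
Let fa_integral_eq f : Cb f -> fa_integral m f = l f.
Proof.
move=> cf; apply: xget_unique.
  have [s hs] := choice (fun n => let: ex_intro2 t tP tQ := alg_simple_approx n cf in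
    ex_intro (fun t => alg_simple t /\ forall x, `|t x - f x| <= n.+1%:R^-1) t (conj tP tQ)).
  exists s; split=> [n|e e0|].
  - by have [] := hs n.
  - near=> n => x; apply: le_lt_trans ((hs n).2 x) _.
    by near: n; exact: near_infty_natSinv_lt (PosNum e0).
  - have /choice[I hI] : forall n, exists I, sintegral m (s n) = I%:E /\
        `|I - l f| <= n.+1%:R^-1 * l one.
      move=> n; have [as_ sf] := hs n.
      by have [I] := sintegral_dist as_ cf sf; exists I.
    under eq_fun do rewrite (hI _).1.
    apply: cvg_EFin; first exact: nearW.
    have l0 := functional_one_ge0.
    have l1 : 0 < l one + 1 by lra.
    apply/cvgrPdist_le => e e0; have d0 := divr_gt0 e0 l1; near=> n.
    rewrite distrC; apply: le_trans (hI n).2 _.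
    have en : n.+1%:R^-1 < e / (l one + 1).
      by near: n; exact: near_infty_natSinv_lt (PosNum d0).
    rewrite ltr_pdivlMr// in en.
    by apply: le_trans (ltW en); rewrite ler_wpM2l ?invr_ge0// lerDl.
move=> I [s [as_ sf sI]].
apply/eqP; rewrite -subr_eq0 -normr_eq0 eq_le normr_ge0 andbT.
apply/ler_addgt0Pr => e e0; rewrite add0r.
have l0 := functional_one_ge0.
have d0 : 0 < e / 2 / (l one + 1) by rewrite !divr_gt0//; lra.
have sI' : fine (sintegral m (s n)) @[n --> \oo] --> I by exact: fine_cvg.
near \oo => n.
have [J sJ Jf] : exists2 J, sintegral m (s n) = J%:E & `|J - l f| <= e / 2 / (l one + 1) * l one.
  apply: sintegral_dist => // x; apply: ltW.
  by move: x; near: n; exact: sf.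
have : `|I - fine (sintegral m (s n))| <= e / 2.
  by near: n; move/cvgrPdist_le : sI'; apply; rewrite divr_gt0.
rewrite sJ/= => IJ.
have dE : e / 2 / (l one + 1) * (l one + 1) = e / 2 by rewrite divfK// gt_eqF//; lra.
have := ler_distD J I (l f).
nra.
Unshelve. all: by end_near. Qed.

Theorem alexandrov_representation :
  exists m' : {content set (closedAlgType X) -> \bar R},
    [/\ m' setT = (l one)%:E, bounded_setfun m', regular_setfun m'
      & forall f, Cb f -> fa_integral m' f = l f].
Proof.
exists m; split; [by rewrite -innerT|exact: m_bounded|exact: m_regular|].
exact: fa_integral_eq.
Qed.

End alexandrov.

(** * Limits of n-th roots, Fekete's lemma and extended logarithms *)

Section nth_roots.
Context {R : realType}.
Implicit Types (a b : nat -> R) (C s x t : R).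

(** At index 0 the exponent is [0^-1 = 0] and the root is 1, so statements that invert the root
    assume [0 < n]. *)
Definition nroot a (n : nat) : R := a n `^ n%:R^-1.

Lemma powR_inv_exprn s (n : nat) : (0 < n)%N -> 0 <= s ->
  (s ^+ n) `^ n%:R^-1 = s.
Proof.
move=> n0 s0; rewrite -powR_mulrn// -powRrM divff ?powRr1//.
by rewrite pnatr_eq0 -lt0n.
Qed.

Lemma powR_invn_cvg1 C : 0 < C -> C `^ n%:R^-1 @[n --> \oo] --> (1 : R).
Proof.
move=> C0; rewrite -[X in _ --> X]expR0; under eq_fun do rewrite /powR gt_eqF//.
apply: continuous_cvg; first exact: continuous_expR.
rewrite -[X in _ --> X](mul0r (ln C)); apply: cvgMl.
apply/cvgrPdist_le => e e0; near=> n; rewrite sub0r normrN ger0_norm ?invr_ge0//.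
have n0 : 0 < n%:R :> R by rewrite ltr0n; near: n; exists 1%N.
have en : e^-1 <= n%:R by near: n; exact: nbhs_infty_ger.
by rewrite invf_ple ?posrE.
Unshelve. all: by end_near. Qed.

Lemma powR_invn_geometric_cvg C s : 0 < C -> 0 <= s ->
  (C * s ^+ n) `^ n%:R^-1 @[n --> \oo] --> s.
Proof.
move=> C0 s0; rewrite -[X in _ --> X]mul1r.
have : C `^ n%:R^-1 * s @[n --> \oo] --> 1 * s.
  by apply: cvgMl; exact: powR_invn_cvg1.
apply: cvg_trans; apply: near_eq_cvg; near=> n.
have n0 : (0 < n)%N by near: n; exists 1%N.
by rewrite (powRM _ (ltW C0) (exprn_ge0 _ s0)) powR_inv_exprn.
Unshelve. all: by end_near. Qed.

Lemma nroot_ge0 a n : 0 <= nroot a n.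
Proof. exact: powR_ge0. Qed.

Lemma ler_nroot a b : (forall n, 0 <= a n <= b n) -> forall n, nroot a n <= nroot b n.
Proof.
move=> ab n; have /andP[a0 abn] := ab n; apply: ge0_ler_powR => //.
by rewrite nnegrE (le_trans a0).
Qed.

Lemma nrootK a n : (0 < n)%N -> 0 <= a n -> nroot a n ^+ n = a n.
Proof.
move=> n0 a0; rewrite -powR_mulrn ?nroot_ge0// /nroot -powRrM mulVf ?powRr1//.
by rewrite pnatr_eq0 -lt0n.
Qed.

(** A constant factor disappears in the limit of n-th roots, so only the ratio [s] of a geometric
    bound matters. *)
Lemma nroot_le_lim a C s x : 0 < C -> 0 <= s -> (forall n, 0 <= a n <= C * s ^+ n) ->
  nroot a @ \oo --> x -> x <= s.
Proof.
move=> C0 s0 aC ax; apply: ler_cvg_to ax (powR_invn_geometric_cvg C0 s0) _.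
by apply: nearW => n; exact: (@ler_nroot a (fun n => C * s ^+ n)).
Qed.

Lemma nroot_ge_lim a C s x : 0 < C -> 0 <= s -> (forall n, C * s ^+ n <= a n) ->
  nroot a @ \oo --> x -> s <= x.
Proof.
move=> C0 s0 aC ax; apply: ler_cvg_to (powR_invn_geometric_cvg C0 s0) ax _.
apply: nearW => n; apply: (@ler_nroot (fun n => C * s ^+ n) a) => {}n.
by rewrite aC andbT mulr_ge0 ?exprn_ge0// ltW.
Qed.

Lemma nroot_lt_near a x t : (forall n, 0 <= a n) -> nroot a @ \oo --> x -> x < t ->
  \forall n \near \oo, a n <= t ^+ n.
Proof.
move=> a0 ax xt; near=> n; rewrite -(@nrootK a n)//; last by near: n; exists 1%N.
have nt : nroot a n <= t by near: n; apply: cvgr_le ax _ xt.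
by apply: lerXn2r => //; rewrite nnegrE ?nroot_ge0// (le_trans (nroot_ge0 a n)).
Unshelve. all: by end_near. Qed.

(* Fekete's lemma, in multiplicative form so that zero terms are allowed. *)
Lemma submultiplicative_nroot_cvg a : (forall n, 0 <= a n) ->
  (forall m n, a (m + n)%N <= a m * a n) -> cvgn (nroot a).
Proof.
move=> a0 aM; pose S := [set nroot a n | n in [set n | (0 < n)%N]].
have iS : has_inf S.
  split; first by exists (nroot a 1), 1%N.
  by exists 0 => _ [n _ <-]; exact: nroot_ge0.
have S0 : 0 <= inf S by apply: lb_le_inf iS.1 _ => _ [n _ <-]; exact: nroot_ge0.
apply/cvg_ex; exists (inf S); apply/cvgrPdist_le => e e0.
have [_ [m /= m0 <-] ms] := inf_adherent (divr_gt0 e0 (ltr0n R 2)) iS.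
set s := inf S + e / 2 in ms.
have s0 : 0 < s by rewrite /s; lra.
have ams : a m <= s ^+ m.
  by rewrite -(nrootK m0 (a0 m)) lerXn2r// ?nnegrE ?nroot_ge0// ltW.
(* Bounds [a r / s^r] for all remainders [r < m]; division of [n] by [m] then gives
   [a n <= C * s^n]. The summand 1 keeps [C] positive. *)
pose C := 1 + \sum_(r < m) a r / s ^+ r.
have Cr (r : nat) : (r < m)%N -> a r / s ^+ r <= C.
  move=> rm; rewrite /C (bigD1 (Ordinal rm))//= addrCA lerDl addr_ge0// sumr_ge0// => i _.
  by rewrite divr_ge0// exprn_ge0// ltW.
have C0 : 0 < C.
  rewrite /C ltr_pwDl// sumr_ge0// => i _.
  by rewrite divr_ge0// exprn_ge0// ltW.
have amul q r : a (q * m + r)%N <= s ^+ (q * m) * a r.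
  elim: q => [|q IH]; first by rewrite mul0n expr0 mul1r.
  rewrite mulSn -addnA (le_trans (aM _ _))// exprD -mulrA.
  exact: ler_pM.
have aC n : 0 <= a n <= C * s ^+ n.
  rewrite a0/= {1 2}(divn_eq n m) (le_trans (amul _ _))// exprD mulrCA ler_wpM2l//.
    by rewrite exprn_ge0// ltW.
  by rewrite -ler_pdivrMr ?exprn_gt0// Cr// ltn_mod.
have Cs := powR_invn_geometric_cvg C0 (ltW s0).
near=> n.
have n0 : (0 < n)%N by near: n; exists 1%N.
have : inf S <= nroot a n by apply: ge_inf; [exact: iS.2|exists n].
have := @ler_nroot a (fun n => C * s ^+ n) aC n.
have : (C * s ^+ n) `^ n%:R^-1 <= inf S + e.
  by near: n; apply: cvgr_le Cs _ _; rewrite /s; lra.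
rewrite {2}/nroot distrC ler_norml => ? ? ?; apply/andP; split; lra.
Unshelve. all: by end_near. Qed.

(** Valid also for [b n = 0], where both sides are [-oo]. *)
Lemma lne_nroot (b : nat -> R) n : (0 < n)%N -> 0 <= b n ->
  ((n%:R^-1)%:E * lne (b n)%:E)%E = lne (nroot b n)%:E.
Proof.
move=> n0; rewrite le_eqVlt => /predU1P[b0|b0].
  rewrite /nroot -b0 powR0; last by rewrite invr_eq0 pnatr_eq0 -lt0n.
  by rewrite le0_lneNy// gt0_muleNy// lte_fin invr_gt0 ltr0n.
by rewrite !lne_EFin ?powR_gt0// /nroot ln_powR.
Qed.

(** At the limit 0 the value is [-oo]: eventually [u n <= expR A], hence [lne (u n) <= A], for every
    [A]. *)
Lemma cvg_lne (u : nat -> R) x : (forall n, 0 <= u n) -> u @ \oo --> x ->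
  lne (u n)%:E @[n --> \oo] --> lne x%:E.
Proof.
move=> u0 ux.
have : 0 <= x by apply: (ler_cvg_to (cvg_cst 0) ux); exact: nearW.
rewrite le_eqVlt => /predU1P[x0|x0].
  rewrite -x0 le0_lneNy//; apply/cvgeNyPle => A; near=> n.
  have [un|un] := leP (u n) 0; first by rewrite le0_lneNy ?leNye// lee_fin.
  rewrite lne_EFin// lee_fin -ler_expR lnK ?posrE//.
  by near: n; apply: cvgr_le ux _ _; rewrite -x0 expR_gt0.
rewrite lne_EFin//.
have : (ln (u n))%:E @[n --> \oo] --> (ln x)%:E.
  apply: cvg_EFin; first exact: nearW.
  exact: (continuous_cvg _ (continuous_ln x0) ux).
apply: cvg_trans; apply: near_eq_cvg; near=> n; rewrite lne_EFin//.
by near: n; apply: cvgr_gt ux _ x0.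
Unshelve. all: by end_near. Qed.

End nth_roots.

(** * Positive operators on bounded measurable functions *)

Section positive_operators.
Context {R : realType} {X : ptopologicalType}.
Implicit Types (f g : X -> R) (K : (X -> R) -> (X -> R)) (r M : R).

Let one : X -> R := cst 1.

Lemma supnorm_le f M : (forall x, `|f x| <= M) -> supnorm f <= M.
Proof.
move=> fM; apply: ge_sup; first by exists `|f point|, point.
by move=> _ [x _ <-].
Qed.

Lemma le_supnorm f x : bounded_fun f -> `|f x| <= supnorm f.
Proof.
move=> /bounded_funP[M fM]; apply: ub_le_sup; last by exists x.
by exists M => _ [y _ <-].
Qed.

Lemma Cb_Bmeas f : Cb f -> Bmeas f.
Proof.
move=> [cf bf]; split=> //.
apply: (measurability _ (RGenOpens.measurableE R)) => _ [_ [a [b ->] <-]].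
rewrite setTI; apply: sub_sigma_algebra.
by apply: open_comp => [x _|]; [exact: cf|exact: interval_open].
Qed.

Lemma linear_on_Bmeas_iter K n : linear_on_Bmeas K -> linear_on_Bmeas (iter n K).
Proof.
move=> [BK DK ZK]; elim: n => [//|n [Bn Dn Zn]]; split=> /= [f Bf|f g Bf Bg|r f Bf].
- exact/BK/Bn.
- by rewrite Dn// DK//; exact: Bn.
- by rewrite Zn// ZK//; exact: Bn.
Qed.

Lemma nonneg_operator_iter K n : linear_on_Bmeas K -> nonneg_operator K ->
  nonneg_operator (iter n K).
Proof.
move=> lK K0; elim: n => [|n IH] g Bg g0 //=; apply: K0; last exact: IH.
by have [Bn _ _] := linear_on_Bmeas_iter n lK; exact: Bn.
Qed.

Lemma Cb_iter K n f : (forall f, Cb f -> Cb (K f)) -> Cb f -> Cb (iter n K f).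
Proof. by move=> CK; elim: n => //= n IH /IH /CK. Qed.

Section one_operator.
Context K (K_linear : linear_on_Bmeas K) (K_nonneg : nonneg_operator K).

Lemma BmeasZ r f : Bmeas f -> Bmeas (fun x => r * f x).
Proof.
move=> [mf /bounded_funP[M fM]]; split; last first.
  by apply/bounded_funP; exists (`|r| * M) => x; rewrite normrM ler_wpM2l.
exact: measurable_funM.
Qed.

Lemma BmeasD f g : Bmeas f -> Bmeas g -> Bmeas (fun x => f x + g x).
Proof.
move=> [mf /bounded_funP[M fM]] [mg /bounded_funP[N gN]]; split; last first.
  apply/bounded_funP; exists (M + N) => x.
  by rewrite (le_trans (ler_normD _ _))// lerD.
exact: measurable_funD.
Qed.

Lemma Bmeas_one : Bmeas one.
Proof. exact/Cb_Bmeas/Cb_cst. Qed.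

Lemma operatorB f g x : Bmeas f -> Bmeas g ->
  K (fun y => f y - g y) x = K f x - K g x.
Proof.
move=> Bf Bg; have [_ DK ZK] := K_linear.
have -> : (fun y => f y - g y) = (fun y => f y + -1 * g y).
  by apply/funext => y; rewrite mulN1r.
by rewrite DK//; [rewrite ZK// mulN1r|exact: BmeasZ].
Qed.

Lemma operator_le f g : Bmeas f -> Bmeas g -> (forall x, f x <= g x) ->
  forall x, K f x <= K g x.
Proof.
move=> Bf Bg fg x; rewrite -subr_ge0 -operatorB//.
apply: K_nonneg => [|y]; last by rewrite subr_ge0.
have -> : (fun y => g y - f y) = (fun y => g y + -1 * f y).
  by apply/funext => y; rewrite mulN1r.
by apply: BmeasD => //; exact: BmeasZ.
Qed.

(** Monotonicity applied to [- M <= f <= M]. *)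
Lemma operator_norm_le f M : Bmeas f -> (forall x, `|f x| <= M) ->
  forall x, `|K f x| <= M * K one x.
Proof.
move=> Bf fM x; have [_ DK ZK] := K_linear.
have KZ r : r * K one x = K (fun x => r * one x) x by rewrite ZK//; exact: Bmeas_one.
rewrite ler_norml -mulNr !KZ; have B1 := Bmeas_one.
by apply/andP; split; apply: operator_le => //;
  try (by apply: BmeasZ) => // y; move=> y; rewrite mulr1; have := fM y;
  rewrite ler_norml => /andP[].
Qed.

Lemma operator_one_ge0 x : 0 <= K one x.
Proof. by apply: K_nonneg; [exact: Bmeas_one|move=> y; exact: ler01]. Qed.

(** For [supnorm g <= 1] positivity gives [|K g| <= K one] pointwise, so the constant 1 attains the
    norm. *)
Lemma opnormE : opnorm K = supnorm (K one).
Proof.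
have [BK _ _] := K_linear; have B1 := Bmeas_one; have [_ bK1] := BK _ B1.
have ub g : Bmeas g -> supnorm g <= 1 -> supnorm (K g) <= supnorm (K one).
  move=> Bg g1; apply: supnorm_le => x.
  have : `|K g x| <= 1 * K one x.
    apply: operator_norm_le => // y; apply: le_trans (le_supnorm _ _) g1.
    by case: Bg.
  rewrite mul1r => /le_trans; apply.
  by apply: le_trans (ler_norm _) _; exact: le_supnorm.
have s1 : supnorm one <= 1 by apply: supnorm_le => x; rewrite normr1.
apply/eqP; rewrite eq_le; apply/andP; split.
  apply: ge_sup; first by exists (supnorm (K one)), one.
  by move=> _ [g [Bg g1] <-]; exact: ub.
apply: ub_le_sup; last by exists one.
by exists (supnorm (K one)) => _ [g [Bg g1] <-]; exact: ub.
Qed.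

Lemma operator_one_le x : K one x <= opnorm K.
Proof.
have [BK _ _] := K_linear; have [_ bK1] := BK _ Bmeas_one.
by rewrite opnormE (le_trans (ler_norm _))//; exact: le_supnorm.
Qed.

Lemma opnorm_ge0 : 0 <= opnorm K.
Proof. exact: le_trans (operator_one_ge0 point) (operator_one_le point). Qed.

Lemma operator_le_opnorm f M : Bmeas f -> (forall x, `|f x| <= M) ->
  forall x, `|K f x| <= M * opnorm K.
Proof.
move=> Bf fM x; apply: le_trans (operator_norm_le Bf fM x) _.
by apply: ler_wpM2l (operator_one_le x); rewrite (le_trans _ (fM x)).
Qed.

Lemma opnorm_le M : (forall x, K one x <= M) -> opnorm K <= M.
Proof.
move=> KM; rewrite opnormE; apply: supnorm_le => x.
by rewrite ger0_norm ?operator_one_ge0.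
Qed.

Lemma operator_sum (c : nat -> R) (F : nat -> X -> R) n x :
  (forall i, Bmeas (F i)) ->
  K (fun y => \sum_(i < n) c i * F i y) x = \sum_(i < n) c i * K (F i) x.
Proof.
move=> BF; have [_ DK ZK] := K_linear.
have BS m : Bmeas (fun y => \sum_(i < m) c i * F i y).
  elim: m => [|m IH]; first by under eq_fun do rewrite big_ord0; exact/Cb_Bmeas/Cb_cst.
  by under eq_fun do rewrite big_ord_recr/=; apply: BmeasD => //; exact: BmeasZ.
elim: n => [|n IH].
  rewrite big_ord0; under eq_fun do rewrite big_ord0.
  have := operatorB x Bmeas_one Bmeas_one.
  by rewrite subrr; under eq_fun do rewrite subrr.
rewrite big_ord_recr/= -IH; under eq_fun do rewrite big_ord_recr/=.
by rewrite (DK _ _ (BS n) (BmeasZ (c n) (BF n))) ZK.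
Qed.

End one_operator.

(** * The spectral radius of a positive operator *)

Section spectral.
Context K (K_linear : linear_on_Bmeas K) (K_nonneg : nonneg_operator K).
Let lin n := linear_on_Bmeas_iter n K_linear.
Let nneg n := nonneg_operator_iter n K_linear K_nonneg.

Lemma opnorm_iter_submul m n :
  opnorm (iter (m + n) K) <= opnorm (iter m K) * opnorm (iter n K).
Proof.
apply: (opnorm_le (lin _) (nneg _)) => x; rewrite iterD mulrC.
have [Bn _ _] := lin n.
apply: le_trans (ler_norm _) _; apply: (operator_le_opnorm (lin _) (nneg _)).
  exact/Bn/Bmeas_one.
move=> y; rewrite ger0_norm; first exact: (operator_one_le (lin _) (nneg _)).
exact: operator_one_ge0.
Qed.

Lemma opnorm_iter_ge0 n : 0 <= opnorm (iter n K).
Proof. exact: opnorm_ge0. Qed.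

(** [limn] denotes an actual limit only once convergence is known; Fekete's lemma provides it. *)
Lemma spectral_radius_cvg :
  nroot (fun n => opnorm (iter n K)) @ \oo --> spectral_radius K.
Proof.
apply: submultiplicative_nroot_cvg => [n|m n].
  exact: opnorm_iter_ge0.
exact: opnorm_iter_submul.
Qed.

Lemma spectral_radius_ge0 : 0 <= spectral_radius K.
Proof.
apply: limr_ge; first by apply/cvg_ex; exists (spectral_radius K); exact: spectral_radius_cvg.
by apply: nearW => n; exact: powR_ge0.
Qed.

(** Iterating the eigenvalue equation at a point where [f] does not vanish bounds [|r|^n] by a
    constant multiple of the norm of [K^n]. *)
Lemma eigenvalue_le_spectral_radius r : eigenvalue_Cb K r -> r <= spectral_radius K.
Proof.
move=> [f [Cf [x fx] Kf]]; apply: le_trans (ler_norm r) _.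
have Bf := Cb_Bmeas Cf; have [_ bf] := Cf; have [_ _ ZK] := K_linear.
have fx0 : 0 < `|f x| by rewrite normr_gt0.
have f0 : 0 < supnorm f by apply: lt_le_trans fx0 (le_supnorm _ bf).
have Knf n y : iter n K f y = r ^+ n * f y.
  suff -> : iter n K f = (fun y => r ^+ n * f y) by [].
  elim: n => [|n IH]; first by apply/funext => z; rewrite expr0 mul1r.
  by rewrite iterS IH ZK// Kf; apply/funext => z; rewrite exprSr mulrA.
apply: (@nroot_ge_lim _ (fun n => opnorm (iter n K)) (`|f x| / supnorm f)) => //.
- by rewrite divr_gt0.
- move=> n; rewrite mulrAC ler_pdivrMr// mulrC -normrX -normrM -Knf mulrC.
  apply: (operator_le_opnorm (lin _) (nneg _)) => // y; exact: le_supnorm.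
- exact: spectral_radius_cvg.
Qed.

End spectral.
End positive_operators.

(** * Truncated Neumann series and the non-negative eigenfunction *)

Section krein_rutman.
Context {R : realType} {X : ptopologicalType}.
Context (K : (X -> R) -> (X -> R)) (K_linear : linear_on_Bmeas K)
  (K_nonneg : nonneg_operator K) (K_Cb : forall f, Cb f -> Cb (K f)).
Implicit Types (f g : X -> R) (e t C M : R).

Let one : X -> R := cst 1.
Let lam := spectral_radius K.
Context (lam_gt0 : 0 < lam).
Let lin n := linear_on_Bmeas_iter n K_linear.
Let nneg n := nonneg_operator_iter n K_linear K_nonneg.

(* Partial sums of the Neumann series of [t (t - K)^-1 f]. *)
Definition neumann t N f : X -> R :=
  fun x => \sum_(n < N) t ^- n * iter n K f x.

Lemma CbI n f : Cb f -> Cb (iter n K f).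
Proof. exact: Cb_iter. Qed.

Lemma Cb_one : Cb one.
Proof. exact: Cb_cst. Qed.

Lemma Cb_neumann t N f : Cb f -> Cb (neumann t N f).
Proof. move=> Cf; apply: (@Cb_sum _ _ N (fun n x => t ^- n * iter n K f x)) => n.
by apply: CbZ; exact: CbI. Qed.

(** Shifting the index turns [K] into multiplication by [t], except at the ends of the sum. *)
Lemma neumann_shift t N f x : t != 0 -> Cb f ->
  neumann t N (K f) x = t * (neumann t N.+1 f x - f x).
Proof.
move=> t0 Cf; rewrite /neumann big_ord_recl/= expr0 invr1 mul1r addrC addKr.
rewrite mulr_sumr; apply: eq_bigr => n _.
by rewrite -iterSr/= /bump/= add1n exprS invfM !mulrA divff// mul1r.
Qed.

Lemma neumannS t N f x : neumann t N.+1 f x = neumann t N f x + t ^- N * iter N K f x.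
Proof. by rewrite /neumann big_ord_recr. Qed.

Lemma neumann_comm t N f : Cb f -> K (neumann t N f) = neumann t N (K f).
Proof.
move=> Cf; apply/funext => x; rewrite /neumann.
rewrite (@operator_sum _ _ K K_linear (fun n => t ^- n) (fun n => iter n K f)).
  by apply: eq_bigr => n _; rewrite -iterSr.
by move=> n; apply: Cb_Bmeas; exact: CbI.
Qed.

Lemma iter_one_ge0 n x : 0 <= iter n K one x.
Proof. exact: operator_one_ge0. Qed.

Lemma neumann_one_ge0 t N x : 0 < t -> 0 <= neumann t N one x.
Proof.
move=> t0; apply: sumr_ge0 => n _.
by rewrite mulr_ge0 ?iter_one_ge0// invr_ge0 exprn_ge0// ltW.
Qed.

Lemma neumann_one_le t N N' x : 0 < t -> (N <= N')%N ->
  neumann t N one x <= neumann t N' one x.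
Proof.
move=> t0 /subnK <-; elim: (N' - N)%N => // n IH; rewrite addSn neumannS.
by rewrite (le_trans IH)// lerDl mulr_ge0 ?iter_one_ge0// invr_ge0 exprn_ge0// ltW.
Qed.

(* If the sums were bounded by [C], then [K w_N <= lam (1 - 1/C) w_(N+1)], so
   that the spectral radius would be at most [lam (1 - 1/C)]. *)
Lemma neumann_unbounded C : exists N x, C < neumann lam N one x.
Proof.
apply: contrapT => nC.
have {}nC N x : neumann lam N one x <= C.
  by rewrite leNgt; apply/negP => Cx; apply: nC; exists N, x.
have lam0 := lt0r_neq0 lam_gt0.
have w1 x : neumann lam 1 one x = 1.
  by rewrite /neumann big_ord_recl big_ord0/= expr0 invr1 mulr1 addr0.
have C1 : 1 <= C by rewrite -(w1 point).
have C0 : 0 < C := lt_le_trans ltr01 C1.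
pose q := 1 - C^-1.
have q0 : 0 <= q by rewrite subr_ge0 invf_le1.
have lq0 : 0 <= lam * q by rewrite mulr_ge0// ltW.
have Cw t N : Cb (neumann t N one) by apply: Cb_neumann; exact: Cb_one.
have wK N x : K (neumann lam N one) x <= lam * q * neumann lam N.+1 one x.
  rewrite neumann_comm; last exact: Cb_one.
  rewrite neumann_shift//; last exact: Cb_one.
  (* A sum bounded by [C] drops by at least its fraction [1 / C] when 1 is subtracted. *)
  rewrite -mulrA ler_pM2l// /q mulrBl mul1r lerD2l lerN2 mulrC.
  by rewrite ler_pdivrMr// mul1r.
have wKj N j x : iter j K (neumann lam N one) x <=
    (lam * q) ^+ j * neumann lam (N + j) one x.
  elim: j x => [|j IH] x; first by rewrite expr0 mul1r addn0.
  rewrite iterS; have [_ _ ZK] := K_linear.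
  have : K (iter j K (neumann lam N one)) x <=
      K (fun y => (lam * q) ^+ j * neumann lam (N + j) one y) x.
    apply: operator_le => //; first by apply: Cb_Bmeas; exact: CbI.
    by apply: Cb_Bmeas; exact: CbZ.
  rewrite ZK; last exact: Cb_Bmeas.
  move/le_trans; apply; rewrite exprSr -mulrA addnS.
  by rewrite ler_wpM2l ?exprn_ge0.
(* The sum of length 1 is the constant 1, so [wKj] bounds [K^n one] by [C * (lam * q)^n]. *)
have : lam <= lam * q.
  apply: (@nroot_le_lim _ (fun n => opnorm (iter n K)) C) => //; last first.
    exact: spectral_radius_cvg.
  move=> n; rewrite opnorm_iter_ge0//=.
  apply: opnorm_le => // x; rewrite mulrC.
  have -> : iter n K (cst 1) = iter n K (neumann lam 1 one).
    by congr (iter n K _); apply/funext => y; rewrite w1.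
  apply: le_trans (wKj _ _ _) _.
  by rewrite ler_wpM2l ?exprn_ge0.
rewrite leNgt => /negP; apply.
by rewrite gtr_pMr// /q ltrBlDr ltrDl invr_gt0.
Qed.

Lemma bernoulli_le (y : R) n : 0 <= y <= 1 -> 1 - n%:R * y <= (1 - y) ^+ n.
Proof.
move=> /andP[y0 y1]; elim: n => [|n IH]; first by rewrite mul0r subr0 expr0.
rewrite exprS -natr1.
have n0 : 0 <= n%:R :> R by [].
have := ler_wpM2l (_ : 0 <= 1 - y) IH; rewrite subr_ge0 => /(_ y1).
nra.
Qed.

(* At such [t] and [N] the truncated Neumann series is large, while its defect
   [K u - t u] in the eigenvalue equation, which consists of the two boundary
   terms of the sum, stays bounded. *)
Lemma resonance e : 0 < e -> exists t N x0,
  [/\ lam < t <= lam + e, t ^- N * opnorm (iter N K) <= 1,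
      e^-1 <= neumann t N one x0 &
      forall x, neumann t N one x <= 2 * neumann t N one x0].
Proof.
move=> e0; have [N0 [x1 Nx]] := neumann_unbounded (2 * e^-1).
(* The first bound gives [(1 - y)^N0 >= 1 / 2] by Bernoulli, so passing from [lam] to
   [t = lam / (1 - y)] at most halves the sum of length [N0]; this is why it was taken above
   [2 / e]. The second bound gives [t <= lam + e]. *)
pose y := Num.min (2 * N0.+1%:R)^-1 (e / (lam + e)).
have le0 : 0 < lam + e by rewrite addr_gt0.
have y0 : 0 < y by rewrite lt_min !(invr_gt0, divr_gt0, mulr_gt0)//.
have yN : 2 * N0.+1%:R * y <= 1.
  by rewrite mulrC -ler_pdivlMr ?mulr_gt0// div1r ge_min lexx.
have ye : y * (lam + e) <= e by rewrite -ler_pdivlMr// ge_min lexx orbT.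
have y1 : y < 1.
  have : 1 <= N0.+1%:R :> R by rewrite ler1n.
  nra.
have y1' : 0 < 1 - y by rewrite subr_gt0.
pose t := lam / (1 - y).
have tE : t * (1 - y) = lam by rewrite /t divfK// gt_eqF.
have t0 : 0 < t by rewrite divr_gt0.
have lt : lam < t by rewrite -tE gtr_pMr// gtrDl oppr_lt0.
have te : t <= lam + e by rewrite ler_pdivrMr//; nra.
have half : 1 / 2 <= (1 - y) ^+ N0.
  apply: le_trans (bernoulli_le _ _); last by rewrite !ltW.
  have : N0%:R + 1 = N0.+1%:R :> R by rewrite natr1.
  nra.
have N0e : e^-1 <= neumann t N0 one x1.
  apply: (@le_trans _ _ (1 / 2 * neumann lam N0 one x1)).
    lra.
  apply: (@le_trans _ _ ((1 - y) ^+ N0 * neumann lam N0 one x1)).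
    rewrite ler_wpM2r// (le_trans _ (ltW Nx))// mulr_ge0// invr_ge0 ltW//.
  rewrite /neumann mulr_sumr; apply: ler_sum => n _.
  rewrite mulrA ler_wpM2r ?iter_one_ge0// -tE exprMn invfM mulrCA.
  rewrite ger_pMr ?invr_gt0 ?exprn_gt0// -exprB ?unitfE ?gt_eqF//; last exact: ltnW.
  by rewrite exprn_ile1 ?ltW// gtrDl oppr_lt0.
(* As [t] exceeds the spectral radius, the last boundary term is at most 1 for large [N], and
   lengthening the sum does not decrease it. *)
have : \forall N \near \oo, (N0 <= N)%N /\ opnorm (iter N K) <= t ^+ N.
  near=> N; split; first by near: N; exists N0.
  near: N; apply: nroot_lt_near lt; last exact: spectral_radius_cvg.
  by move=> n; exact: opnorm_iter_ge0.
case=> N _ /(_ N (leqnn _))[NN aN].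
have {}N0e : e^-1 <= neumann t N one x1.
  by apply: le_trans N0e _; exact: neumann_one_le.
have tN : t ^- N * opnorm (iter N K) <= 1.
  by rewrite mulrC ler_pdivrMr ?exprn_gt0// mul1r.
set u := neumann t N one in N0e *.
(* Either [x1] already reaches half the supremum, or some point above half the supremum has a larger
   value than [x1]. *)
have [x0 [x0e x0u]] : exists x0, e^-1 <= u x0 /\ forall x, u x <= 2 * u x0.
  have [_ bu] : Cb u by apply: Cb_neumann; exact: Cb_one.
  have us x : u x <= supnorm u by apply: le_trans (ler_norm _) (le_supnorm _ bu).
  have e1 : 0 < e^-1 by rewrite invr_gt0.
  have [su|su] := leP (supnorm u) (2 * u x1).
    by exists x1; split=> // x; apply: le_trans (us x) _.
  have [||_ [x0 _ <-] xs] := @sup_adherent _ (range (fun x => `|u x|)) (supnorm u / 2).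
  - by have := us x1; lra.
  - split; first by exists `|u x1|, x1.
    by exists (supnorm u) => _ [x _ <-]; exact: le_supnorm.
  have u0 : 0 <= u x0 by exact: neumann_one_ge0.
  rewrite (ger0_norm u0) -/(supnorm u) in xs.
  by exists x0; split=> [|x]; have := us x1; [|have := us x]; lra.
by exists t, N, x0; split=> //; rewrite lt.
Unshelve. all: by end_near. Qed.

(** By [neumann_shift] the defect is [t * (t^-N * K^N f - f)], and the assumption on [N] bounds each
    of the two terms in the bracket by [M]. *)
Lemma neumann_defect t N f M x : 0 < t -> t ^- N * opnorm (iter N K) <= 1 ->
  Cb f -> (forall x, `|f x| <= M) ->
  `|neumann t N (K f) x - t * neumann t N f x| <= t * (2 * M).
Proof.
move=> t0 tN Cf fM; rewrite neumann_shift ?gt_eqF// neumannS.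
rewrite -mulrBr normrM (gtr0_norm t0) ler_pM2l// addrAC (addrAC (neumann _ _ _ _)) subrr add0r.
have M0 : 0 <= M := le_trans (normr_ge0 _) (fM x).
have tN0 : 0 <= t ^- N by rewrite invr_ge0 exprn_ge0// ltW.
have : `|t ^- N * iter N K f x| <= M.
  rewrite normrM ger0_norm//.
  have := @operator_le_opnorm _ _ _ (lin N) (nneg N) f M (Cb_Bmeas Cf) fM x.
  move=> /(ler_wpM2l tN0)/le_trans; apply.
  by rewrite mulrCA ler_piMr.
have := fM x; have := ler_normB (t ^- N * iter N K f x) (f x); lra.
Qed.

(** The resonant sum [u] is scaled to [u / (2 u(x0))]: the value 1/2 at [x0] keeps limits from
    vanishing, and the bounded defect becomes small. The constant combines [2 t <= 2 (lam + 1)] from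
    the defect with 1 from [t - lam <= e]. *)
Lemma approximate_eigenfunctions e : 0 < e -> exists v : X -> R,
  [/\ Cb v, forall x, 0 <= v x <= 1, exists x, v x = 1 / 2 &
      forall x, `|K v x - lam * v x| <= (2 * lam + 3) * e].
Proof.
(* With [e <= 1] one has [t <= lam + 1]; for larger [e] the function obtained for 1 serves. *)
wlog e1 : e / e <= 1 => [hw e0|e0].
  have [|e1] := leP e 1; first by move=> ?; exact: hw.
  have [v [Cv v01 v12 vK]] := hw 1 (lexx _) ltr01; exists v; split => // x.
  apply: le_trans (vK x) _; apply: ler_wpM2l (ltW e1).
  by rewrite addr_ge0// mulr_ge0// ltW.
have [t [N [x0 [/andP[lt te] tN x0e x0u]]]] := resonance e0.
have t0 : 0 < t := lt_trans lam_gt0 lt.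
have u0 : 0 < neumann t N one x0 by apply: lt_le_trans x0e; rewrite invr_gt0.
set u := neumann t N one in x0e x0u u0 *.
have Cu : Cb u by apply: Cb_neumann; exact: Cb_one.
pose c := (2 * u x0)^-1.
have c0 : 0 < c by rewrite invr_gt0 mulr_gt0.
have ce : c <= e by rewrite /c invf_ple ?posrE ?mulr_gt0//; lra.
have cu : c * (2 * u x0) = 1 by rewrite /c mulVf// gt_eqF// mulr_gt0.
have v01 x : 0 <= c * u x <= 1.
  rewrite mulr_ge0 ?neumann_one_ge0 ?(ltW c0)//= -[leRHS]cu.
  by rewrite ler_wpM2l ?(ltW c0).
exists (fun x => c * u x); split=> //.
- exact: CbZ.
- by exists x0; have := cu; lra.
move=> x; have [_ _ ZK] := K_linear; rewrite ZK; last exact: Cb_Bmeas.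
have : `|K u x - t * u x| <= t * (2 * 1).
  rewrite /u neumann_comm; last exact: Cb_one.
  by apply: neumann_defect => //; [exact: Cb_one|move=> y; rewrite normr1].
rewrite -(ler_pM2l c0) -{1}(gtr0_norm c0) -normrM.
have -> : c * (K u x - t * u x) = c * K u x - lam * (c * u x) - (t - lam) * (c * u x) by ring.
have := v01 x; move: (c * K u x) (c * u x) => p q /andP[q0 q1].
have := ler_normD (p - lam * q - (t - lam) * q) ((t - lam) * q).
rewrite subrK (ger0_norm (_ : 0 <= (t - lam) * q)); last by rewrite mulr_ge0// subr_ge0 ltW.
nra.
Qed.

(** Each step multiplies the old error by at most the norm of [K] and adds [lam^n * d]; the constant
    is the same for all [v] and [d]. *)
Lemma iter_approximate_eigenfunction n : exists2 C, 0 <= C &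
  forall v d, Cb v -> (forall x, `|K v x - lam * v x| <= d) ->
  forall x, `|iter n K v x - lam ^+ n * v x| <= C * d.
Proof.
elim: n => [|n [C C0 IH]].
  by exists 0 => // v d _ _ x; rewrite expr0 mul1r subrr normr0 mul0r.
exists (C * opnorm K + lam ^+ n).
  by rewrite addr_ge0 ?mulr_ge0 ?exprn_ge0 ?opnorm_ge0// ltW.
move=> v d Cv vd x; have [_ _ ZK] := K_linear.
have BI : Bmeas (iter n K v) by apply: Cb_Bmeas; exact: CbI.
have Bv : Bmeas (fun x => lam ^+ n * v x) by apply: Cb_Bmeas; exact: CbZ.
pose w y := iter n K v y - lam ^+ n * v y.
have Cw : Cb w by apply: CbD; [exact: CbI|apply: CbN; exact: CbZ].
have := @operator_le_opnorm _ _ _ K_linear K_nonneg w (C * d) (Cb_Bmeas Cw) (IH v d Cv vd) x.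
rewrite /w operatorB// ZK; last exact: Cb_Bmeas.
rewrite iterS => hw.
have -> : K (iter n K v) x - lam ^+ n.+1 * v x =
    (K (iter n K v) x - lam ^+ n * K v x) + lam ^+ n * (K v x - lam * v x).
  by rewrite exprSr; ring.
apply: le_trans (ler_normD _ _) _; rewrite mulrDl; apply: lerD.
  by rewrite mulrAC.
rewrite normrM ger0_norm ?exprn_ge0 ?(ltW lam_gt0)//.
by rewrite ler_wpM2l ?exprn_ge0 ?(ltW lam_gt0).
Qed.

(* [v_j] approximate eigenfunctions; [K^k v_j] converges along a subsequence
   and is close to [lam^k v_j], hence [v_j] itself converges. *)
Lemma eigenfunction_exists (k : nat) : compact_on_Cb (iter k K) ->
  exists2 psi, eigenfunction_Cb K lam psi & forall x, 0 <= psi x.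
Proof.
move=> K_compact.
have l0 := lam_gt0; have lk0 : 0 < lam ^+ k by rewrite exprn_gt0.
have l3 : 0 < 2 * lam + 3 by lra.
have j0 j : 0 < j.+1%:R^-1 :> R by rewrite invr_gt0.
have [v hv] := choice (fun j => approximate_eigenfunctions (j0 j)).
have [phi [h [phi_mono Ch hcvg]]] : exists phi h, [/\ {homo phi : i j / (i < j)%N},
    Cb h & supnorm (fun x => iter k K (v (phi n)) x - h x) @[n --> \oo] --> 0].
  apply: K_compact => j; have [Cv v01 _ _] := hv j; split=> //.
  by apply: supnorm_le => x; have /andP[v0 v1] := v01 x; rewrite ger0_norm.
have phi_ge j : (j <= phi j)%N.
  by elim: j => // j IH; rewrite (leq_ltn_trans IH)// phi_mono.
have [C C0 hC] := iter_approximate_eigenfunction k.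
(* [K^k v] is close both to [lam^k v] and, along the subsequence, to [h]. *)
pose psi x := lam ^- k * h x.
have Cpsi : Cb psi by exact: CbZ.
have approx e : 0 < e -> exists w, [/\ Cb w, forall x, 0 <= w x,
    exists x, w x = 1 / 2, forall x, `|K w x - lam * w x| <= e &
    forall x, `|w x - psi x| <= e].
  move=> e0; pose d := Num.min e (e * lam ^+ k / (2 * (C + 1))).
  have C1 : 0 < 2 * (C + 1) by lra.
  have d0 : 0 < d by rewrite lt_min e0 divr_gt0// mulr_gt0.
  have dC : C * d <= e * lam ^+ k / 2.
    have : d * (2 * (C + 1)) <= e * lam ^+ k by rewrite -ler_pdivlMr// ge_min lexx orbT.
    lra.
  have d3 : 0 < d / (2 * lam + 3) by rewrite divr_gt0.
  have ek : 0 < e * lam ^+ k / 2 by rewrite divr_gt0 ?mulr_gt0.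
  near \oo => j.
  have sj : supnorm (fun x => iter k K (v (phi j)) x - h x) <= e * lam ^+ k / 2.
    by near: j; apply: cvgr_le hcvg _ ek.
  have jd : j.+1%:R^-1 < d / (2 * lam + 3).
    by near: j; exact: near_infty_natSinv_lt (PosNum d3).
  have [Cv v01 v12 vK] := hv (phi j).
  have {}vK x : `|K (v (phi j)) x - lam * v (phi j) x| <= d.
    apply: le_trans (vK x) _; rewrite mulrC -ler_pdivlMr//.
    by apply: le_trans (ltW jd); rewrite lef_pV2 ?posrE// ler_nat ltnS.
  exists (v (phi j)); split=> // x.
  - by have /andP[] := v01 x.
  - by apply: le_trans (vK x) _; rewrite ge_min lexx.
  have CI : Cb (fun x => iter k K (v (phi j)) x - h x).
    by apply: CbD; [exact: CbI|exact: CbN].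
  have := le_supnorm x CI.2; have := hC _ _ Cv vK x.
  have -> : v (phi j) x - psi x = lam ^- k * ((iter k K (v (phi j)) x - h x) -
      (iter k K (v (phi j)) x - lam ^+ k * v (phi j) x)).
    by rewrite /psi; field; rewrite expf_neq0// gt_eqF.
  rewrite normrM ger0_norm ?invr_ge0 ?(ltW lk0)// ler_pdivrMl//.
  move=> h1 h2; apply: le_trans (ler_normB _ _) _; lra.
have psi0 x : 0 <= psi x.
  rewrite leNgt; apply/negP => px.
  have [|w [_ w0 _ _ wp]] := approx (- psi x / 2); first lra.
  have := wp x; have := w0 x; rewrite ler_norml => ? /andP[]; lra.
exists psi => //; split=> //.
  (* Where [w] equals 1/2, a function within distance 1/4 cannot vanish. *)
  have [|w [_ _ [x wx] _ wp]] := approx (1 / 4); first lra.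
  exists x; apply/eqP => px; have := wp x.
  by rewrite px wx subr0 ger0_norm; lra.
apply/funext => x; apply/eqP; rewrite -subr_eq0 -normr_eq0 eq_le normr_ge0 andbT.
have a0 : 0 <= opnorm K by exact: opnorm_ge0.
apply/ler_addgt0Pr => e e0; rewrite add0r.
(* Replacing [psi] by [w] costs [opnorm K * d] inside [K] and [lam * d] in the multiple; the defect
   of [w] adds [d]. *)
have s0 : 0 < opnorm K + 1 + lam by lra.
have [w [Cw _ _ wK wp]] := approx _ (divr_gt0 e0 s0).
set d := e / _ in wK wp.
have dE : d * (opnorm K + 1 + lam) = e by rewrite /d divfK// gt_eqF.
have := @operator_le_opnorm _ _ _ K_linear K_nonneg (fun y => w y - psi y) d
  (Cb_Bmeas (CbD Cw (CbN Cpsi))) wp x.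
rewrite operatorB//; [|exact: Cb_Bmeas|exact: Cb_Bmeas].
have := wK x; have := wp x; rewrite !ler_norml => /andP[? ?] /andP[? ?] /andP[? ?].
apply/andP; split; nra.
Unshelve. all: by end_near. Qed.

End krein_rutman.

(** * The positive left eigenfunctional *)

Section left_eigenfunctional.
Context {R : realType} {X : ptopologicalType}.
Context (K : (X -> R) -> (X -> R)) (K_linear : linear_on_Bmeas K)
  (K_nonneg : nonneg_operator K) (K_Cb : forall f, Cb f -> Cb (K f)).
Implicit Types (f g : X -> R) (e t C M : R).

Let one : X -> R := cst 1.
Let lam := spectral_radius K.
Context (lam_gt0 : 0 < lam).
Let lin n := linear_on_Bmeas_iter n K_linear.
Let nneg n := nonneg_operator_iter n K_linear K_nonneg.

(** Compactness of the segment gives a cluster point, and an ultrafilter converges to each of its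
    cluster points. *)
Lemma bounded_ultra_cvg (U : set_system nat) (u : nat -> R) M : UltraFilter U ->
  (forall j, `|u j| <= M) -> cvg (u @ U).
Proof.
move=> UU uM.
have [|p [_ pU]] := @segment_compact R (- M) M (u @ U) _.
  apply: (@filterE _ U _ (u @^-1` `[- M, M])) => j.
  by have := uM j; rewrite /= in_itv/= ler_norml.
apply/cvg_ex; exists p => B pB.
have [//|UB] := in_ultra_setVsetC (u @^-1` B) UU.
by have [y [nBy By]] := pU (~` B) B UB pB.
Qed.

Lemma neumann_normalized_le t N f M x : 0 < t -> Cb f -> (forall x, `|f x| <= M) ->
  `|neumann K t N f x| <= M * neumann K t N one x.
Proof.
move=> t0 Cf fM; rewrite /neumann mulr_sumr.
apply: le_trans (ler_norm_sum _ _ _) _; apply: ler_sum => n _.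
rewrite normrM ger0_norm ?invr_ge0 ?exprn_ge0 ?(ltW t0)// mulrCA.
rewrite ler_wpM2l ?invr_ge0 ?exprn_ge0 ?(ltW t0)//.
exact: (operator_norm_le (lin n) (nneg n) (Cb_Bmeas Cf) fM).
Qed.

(* The functional is the limit along an ultrafilter of normalised truncated
   Neumann series evaluated at points where they are almost maximal. *)
Lemma left_eigenfunctional : exists l : (X -> R) -> R,
  [/\ forall f g, Cb f -> Cb g -> l (fun x => f x + g x) = l f + l g,
      forall r f, Cb f -> l (fun x => r * f x) = r * l f,
      forall f, Cb f -> (forall x, 0 <= f x) -> 0 <= l f,
      l one = 1 & forall f, Cb f -> l (K f) = lam * l f].
Proof.
have j0 j : 0 < j.+1%:R^-1 :> R by rewrite invr_gt0.
have res j : exists p : R * nat * X, let: (t, N, x0) := p in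
    [/\ lam < t <= lam + j.+1%:R^-1, t ^- N * opnorm (iter N K) <= 1 &
      j.+1%:R <= neumann K t N one x0].
  have [t [N [x0 [h1 h2 h3 _]]]] := resonance K_linear K_nonneg K_Cb lam_gt0 (j0 j).
  by exists (t, N, x0); split=> //; rewrite -[leLHS]invrK.
have [p hp] := choice res.
pose L j f := let: (t, N, x0) := p j in neumann K t N f x0 / neumann K t N one x0.
have LD j f g : Cb f -> Cb g -> L j (fun x => f x + g x) = L j f + L j g.
  move=> Cf Cg; rewrite /L; case: (p j) => [[t N] x0]; rewrite -mulrDl; congr (_ / _).
  rewrite /neumann -big_split/=; apply: eq_bigr => n _.
  by have [_ Dn _] := lin n; rewrite (Dn _ _ (Cb_Bmeas Cf) (Cb_Bmeas Cg)) mulrDr.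
have LZ j r f : Cb f -> L j (fun x => r * f x) = r * L j f.
  move=> Cf; rewrite /L; case: (p j) => [[t N] x0]; rewrite mulrA; congr (_ / _).
  rewrite /neumann mulr_sumr; apply: eq_bigr => n _.
  by have [_ _ Zn] := lin n; rewrite (Zn _ _ (Cb_Bmeas Cf)) mulrCA.
have L0 j f : Cb f -> (forall x, 0 <= f x) -> 0 <= L j f.
  move=> Cf f0; rewrite /L; have := hp j; case: (p j) => [[t N] x0] [/andP[lt _] _ ju].
  have t0 : 0 < t := lt_trans lam_gt0 lt.
  rewrite divr_ge0//; last by apply: le_trans ju.
  apply: sumr_ge0 => n _; rewrite mulr_ge0 ?invr_ge0 ?exprn_ge0 ?(ltW t0)//.
  exact: (nneg n (Cb_Bmeas Cf) f0).
have L1 j : L j one = 1.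
  rewrite /L; have := hp j; case: (p j) => [[t N] x0] [_ _ ju].
  by rewrite divff// gt_eqF//; apply: lt_le_trans ju.
have Lle j f M : Cb f -> (forall x, `|f x| <= M) -> `|L j f| <= M.
  move=> Cf fM; rewrite /L; have := hp j; case: (p j) => [[t N] x0] [/andP[lt _] _ ju].
  have t0 : 0 < t := lt_trans lam_gt0 lt.
  have u0 : 0 < neumann K t N one x0 by apply: lt_le_trans ju.
  rewrite normrM normfV (gtr0_norm u0) ler_pdivrMr//.
  exact: neumann_normalized_le.
(* Two errors occur: the defect of the sum, divided by its large value at [one], and the gap between
   [t] and [lam]. *)
have LK j f M : Cb f -> (forall x, `|f x| <= M) ->
    `|L j (K f) - lam * L j f| <= (2 * lam + 3) * M * j.+1%:R^-1.
  move=> Cf fM; have := Lle j f M Cf fM; rewrite /L; have := hp j.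
  case: (p j) => [[t N] x0] [/andP[lt te] tN ju].
  have t0 : 0 < t := lt_trans lam_gt0 lt.
  have u0 : 0 < neumann K t N one x0 by apply: lt_le_trans ju.
  have := neumann_defect K_linear K_nonneg x0 t0 tN Cf fM.
  set c := neumann K t N one x0 in ju u0 *.
  set a := neumann K t N (K f) x0; set b := neumann K t N f x0 => ab bM.
  have M0 : 0 <= M := le_trans (normr_ge0 _) (fM x0).
  have cj : c^-1 <= j.+1%:R^-1 by rewrite lef_pV2 ?posrE.
  have -> : a / c - lam * (b / c) = (a - t * b) / c + (t - lam) * (b / c) by ring.
  apply: le_trans (ler_normD _ _) _; rewrite !normrM normfV (gtr0_norm u0).
  have j1 : j.+1%:R^-1 <= 1 :> R by rewrite invf_le1 ?ler1n.
  have h1 : `|a - t * b| / c <= t * (2 * M) * j.+1%:R^-1.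
    by apply: ler_pM => //; rewrite ?invr_ge0 ?(ltW u0).
  have h2 : `|t - lam| * (`|b| / c) <= j.+1%:R^-1 * M.
    rewrite normrM normfV (gtr0_norm u0) in bM.
    apply: ler_pM bM => //; first by rewrite divr_ge0// ltW.
    by rewrite gtr0_norm ?subr_gt0// lerBlDl.
  have h3 : t * (2 * M) * j.+1%:R^-1 <= (lam + 1) * (2 * M) * j.+1%:R^-1.
    rewrite ler_wpM2r ?(ltW (j0 j))// ler_wpM2r ?mulr_ge0//.
    by rewrite (le_trans te)// lerD2l.
  move: h1 h2 h3; move: (j.+1%:R^-1) => q; lra.
(* An ultrafilter finer than [\oo] makes [L j f] converge for all [f] at once, with no subsequence
   depending on [f], and preserves limits along [\oo]. *)
have [U [UU sU]] := @ultraFilterLemma nat \oo _.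
pose l f : R := lim (L j f @[j --> U]).
have cvgL f : Cb f -> L j f @[j --> U] --> l f.
  move=> Cf; have [_ /bounded_funP[M fM]] := Cf.
  by apply: bounded_ultra_cvg => j; exact: Lle fM.
have lim_eq (u : nat -> R) f a : (forall j, L j f = u j) -> u @ U --> a -> l f = a.
  move=> uE ua; have uf : L ^~ f = u by exact/funext.
  by rewrite /l uf; apply: cvg_lim ua; exact: Rhausdorff.
exists l; split.
- move=> f g Cf Cg; apply: (lim_eq (fun j => L j f + L j g)).
    by move=> j; exact: LD.
  by apply: cvgD; exact: cvgL.
- move=> r f Cf; apply: (lim_eq (fun j => r * L j f)).
    by move=> j; exact: LZ.
  by apply: cvgMr; exact: cvgL.
- move=> f Cf f0; apply: limr_ge; first by apply/cvg_ex; exists (l f); exact: cvgL.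
  by apply: nearW => j; exact: L0.
- by apply: (lim_eq (fun=> 1)) => //; exact: cvg_cst.
move=> f Cf; have [_ /bounded_funP[M fM]] := Cf.
apply: (lim_eq (fun j => (L j (K f) - lam * L j f) + lam * L j f)).
  by move=> j; rewrite subrK.
rewrite -[X in _ --> X]add0r; apply: cvgD; last by apply: cvgMr; exact: cvgL.
suff : L j (K f) - lam * L j f @[j --> \oo] --> 0.
  by move=> h B /h; exact: sU.
have M0 : 0 <= M := le_trans (normr_ge0 _) (fM point).
(* [M] may be 0; the bound [M + 1] makes the constant positive. *)
have c0 : 0 < (2 * lam + 3) * (M + 1) by have := lam_gt0; nra.
apply/cvgrPdist_le => e e0; have d0 := divr_gt0 e0 c0; near=> j.
rewrite sub0r normrN; apply: le_trans (LK j f (M + 1) Cf _) _.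
  by move=> x; rewrite (le_trans (fM x))// lerDl.
rewrite mulrC -ler_pdivlMr//; apply: ltW.
by near: j; exact: near_infty_natSinv_lt (PosNum d0).
Unshelve. all: by end_near. Qed.

End left_eigenfunctional.

(** * Logarithmic growth of the integrated iterates *)

Section growth.
Context {R : realType} {X : ptopologicalType}.
Context (K : (X -> R) -> (X -> R)) (K_linear : linear_on_Bmeas K)
  (K_nonneg : nonneg_operator K) (K_Cb : forall f, Cb f -> Cb (K f)).
Context (k : nat) (K_compact : compact_on_Cb (iter k K)).
Context (mu : probability (borelType X) R).
Context (mu_open : forall U : set X, open U -> U !=set0 -> (0 < mu U)%E).

Let one : X -> R := cst 1.
Let lam := spectral_radius K.
Let lin n := linear_on_Bmeas_iter n K_linear.
Let nneg n := nonneg_operator_iter n K_linear K_nonneg.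
Let I n := (\int[mu]_x (iter n K one x)%:E)%E.

Let measurable_iter_one n :
  measurable_fun [set: borelType X] (fun x : borelType X => (iter n K one x)%:E).
Proof.
have [Bn _ _] := lin n; have [mf _] := Bn one (Cb_Bmeas (Cb_cst 1)).
exact/measurable_EFinP.
Qed.

Let I_ge0 n : (0 <= I n)%E.
Proof.
by apply: integral_ge0 => x _; rewrite lee_fin; exact: operator_one_ge0 (nneg n) x.
Qed.

Let I_le n : (I n <= (opnorm (iter n K))%:E)%E.
Proof.
apply: (@le_trans _ _ (\int[mu]_x (cst (opnorm (iter n K))%:E x)))%E.
  apply: ge0_le_integral => //.
  - by move=> x _; rewrite lee_fin; exact: operator_one_ge0 (nneg n) x.
  - by move=> x _; rewrite lee_fin; exact: operator_one_le (lin n) (nneg n) x.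
rewrite (integral_cst mu measurableT) [X in (_ * X)%E](_ : _ = 1%E) ?mule1//.
exact: probability_setT.
Qed.

Let I_fin n : I n = (fine (I n))%:E.
Proof.
rewrite fineK// ge0_fin_numE//; exact: le_lt_trans (I_le n) (ltry _).
Qed.

(** On the open set where [psi] exceeds half of its positive value at [x0], the comparison
    [psi <= s * one] bounds [K^n one] below by a fixed multiple of [lam^n]. *)
Let I_ge : 0 < lam -> exists2 c : R, 0 < c & forall n, c * lam ^+ n <= fine (I n).
Proof.
move=> lam0; have [psi [Cpsi [x0 psix0] Kpsi] psi0] :=
  eigenfunction_exists K_linear K_nonneg K_Cb lam0 K_compact.
have [cpsi bpsi] := Cpsi; have [_ _ ZK] := K_linear.
have px0 : 0 < psi x0 by rewrite lt_def psix0 psi0.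
pose s := supnorm psi.
have psi_s x : psi x <= s by apply: le_trans (ler_norm _) (le_supnorm _ bpsi).
have s0 : 0 < s := lt_le_trans px0 (psi_s x0).
pose U := [set x | psi x0 / 2 < psi x].
have oU : open U by exact: open_gt_preimage.
have mU : measurable (U : set (borelType X)) by exact: sub_sigma_algebra.
have U0 : U !=set0 by exists x0; rewrite /U/=; lra.
have muU : 0 < fine (mu U).
  by rewrite fine_gt0// mu_open//= (le_lt_trans (probability_le1 mu mU))// ltry.
exists (psi x0 / 2 / s * fine (mu U)); first by rewrite !(mulr_gt0, invr_gt0).
move=> n.
have Kn x : lam ^+ n * psi x / s <= iter n K one x.
  have -> : lam ^+ n * psi x = iter n K psi x.
    suff -> : iter n K psi = (fun y => lam ^+ n * psi y) by [].
    elim: n => [|n IH]; first by apply/funext => y; rewrite expr0 mul1r.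
    rewrite iterS IH ZK; last exact: Cb_Bmeas.
    by rewrite Kpsi; apply/funext => y; rewrite exprSr mulrA.
  have [_ _ Zn] := lin n; rewrite ler_pdivrMr// mulrC.
  have -> : s * iter n K one x = iter n K (fun y => s * one y) x.
    by rewrite (Zn _ _ (Cb_Bmeas (Cb_cst 1))).
  apply: (operator_le (lin n) (nneg n)) => [||y].
  - exact: Cb_Bmeas.
  - by apply: Cb_Bmeas; apply: CbZ; exact: Cb_cst.
  - by rewrite /one /= mulr1.
rewrite -lee_fin -I_fin /I.
apply: (@le_trans _ _ (\int[mu]_(x in U) (iter n K one x)%:E))%E; last first.
  apply: ge0_subset_integral => // x _.
  by rewrite lee_fin; exact: operator_one_ge0 (nneg n) x.
apply: (@le_trans _ _ (\int[mu]_(x in U) (cst (psi x0 / 2 / s * lam ^+ n)%:E x)))%E.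
  rewrite integral_cst// [X in (_ * X)%E](_ : _ = (fine (mu U))%:E).
    by rewrite -EFinM lee_fin mulrAC.
  by rewrite fineK// fin_num_measure.
apply: ge0_le_integral => //.
- by move=> x _; rewrite lee_fin !mulr_ge0 ?invr_ge0 ?exprn_ge0 ?(ltW s0) ?(ltW lam0).
- exact: measurable_funS (measurable_iter_one n).
move=> x Ux; rewrite lee_fin; apply: le_trans (Kn x).
rewrite mulrAC ler_pM2r ?invr_gt0// mulrC ler_pM2l ?exprn_gt0//.
exact: ltW.
Qed.

(** The n-th roots of the integrals are squeezed towards [lam], and the logarithm is taken last. For
    [lam = 0] the lower bound is 0 and the limit is [-oo]. *)
Lemma log_growth_cvg :
  ((n%:R^-1)%:E * lne (I n))%E @[n --> \oo] --> lne lam%:E.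
Proof.
pose b n := fine (I n).
have b0 n : 0 <= b n by exact/fine_ge0/I_ge0.
have ba n : b n <= opnorm (iter n K) by rewrite -lee_fin -I_fin.
suff bl : nroot b @ \oo --> lam.
  have := cvg_lne (nroot_ge0 b) bl.
  apply: cvg_trans; apply: near_eq_cvg; near=> n.
  have n0 : (0 < n)%N by near: n; exists 1%N.
  by rewrite -(lne_nroot n0 (b0 n)) -I_fin.
have upper := spectral_radius_cvg K_linear K_nonneg.
have nba n : nroot b n <= nroot (fun n => opnorm (iter n K)) n.
  by apply: ler_nroot => {}n; rewrite b0 ba.
have := spectral_radius_ge0 K_linear K_nonneg.
rewrite le_eqVlt => /predU1P[lam0|lam0].
  have l0 : lam = 0 by rewrite /lam -lam0.
  rewrite l0; apply: (squeeze_cvgr _ (cvg_cst 0)); last first.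
    by rewrite -[X in _ --> X]l0; exact: upper.
  by apply: nearW => n; rewrite nroot_ge0 nba.
have [c c0 cb] := I_ge lam0.
apply: squeeze_cvgr (powR_invn_geometric_cvg c0 (ltW lam0)) upper.
apply: nearW => n; rewrite nba andbT.
apply: (@ler_nroot _ (fun n => c * lam ^+ n)) => {}n.
by rewrite cb mulr_ge0 ?exprn_ge0 ?(ltW c0) ?(ltW lam0).
Unshelve. all: by end_near. Qed.

End growth.

(** * Growth rate, eigenfunction and left eigenmeasure combined *)

Theorem theorem1p2 (R : realType) (T : completePseudoMetricType R)
    (polishT : polish T)
    (S : set T) (borelS : (@open T).-sigma.-measurable S) (s0 : S)
    (K : (psubspace s0 -> R) -> (psubspace s0 -> R))
    (K_linear : linear_on_Bmeas K)
    (K_nonneg : nonneg_operator K)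
    (K_Cb : forall f, Cb f -> Cb (K f))
    (k : nat) (k_ge1 : (1 <= k)%N)
    (K_compact : compact_on_Cb (iter k K))
    (mu : probability (borelType (psubspace s0)) R)
    (mu_open : forall U : set (psubspace s0),
       open U -> U !=set0 -> (0 < mu U)%E) :
  ((fun n : nat =>
      (n%:R^-1)%:E * lne (\int[mu]_x (iter n K (cst 1) x)%:E))%E @ \oo
     --> lne (spectral_radius K)%:E) /\
  (0 < spectral_radius K ->
   [/\ eigenvalue_Cb K (spectral_radius K) /\
         (forall r : R, eigenvalue_Cb K r -> r <= spectral_radius K),
       exists psi : psubspace s0 -> R,
         eigenfunction_Cb K (spectral_radius K) psi /\
         (forall x, 0 <= psi x)
     & exists m : {content set (closedAlgType (psubspace s0)) -> \bar R},
         [/\ exists2 A, measurable A & m A != 0%E,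
             bounded_setfun m,
             regular_setfun m
           & forall f, Cb f ->
               fa_integral m (K f) = spectral_radius K * fa_integral m f]]).
Proof.
split; first exact: log_growth_cvg K_linear K_nonneg K_Cb _ K_compact _ mu_open.
move=> lam0.
have [psi Kpsi psi0] := eigenfunction_exists K_linear K_nonneg K_Cb lam0 K_compact.
split.
- by split; [exists psi|exact: eigenvalue_le_spectral_radius].
- by exists psi.
have [l [lD lZ l0 l1 lK]] := left_eigenfunctional K_linear K_nonneg K_Cb lam0.
(* The relative topology of [S] comes from a pseudometric, which yields the normality needed for
   Urysohn functions. *)
have nX : normal_space (psubspace s0) by exact: (@pseudometric_normal R (set_type S)).
have [m [mT mb mr mI]] := alexandrov_representation nX lD lZ l0.
exists m; split=> // [|f Cf].
  by exists setT; [exact: measurableT|rewrite mT l1 onee_neq0].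
by rewrite !mI ?lK//; exact: K_Cb.
Qed.
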